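(* Let $F=F(X)$ be in $L^2(P)$ with mean zero. Then $$d_K(F,N)\le E|1-Z|+B_1+B_2\le |1-E[F^2]|+\sqrt{\mathrm{Var}(Z)}+B_1+B_2,$$ where $$Z:=\sum_{i=1}^{\infty}\mathfrak{D}_iF\,E[\mathfrak{D}_iF|\mathcal{F}_i],$$ $$B_1:=\sup_{x\in\mathbb{R}}E\left[\sum_{i=1}^{\infty}\Big(\mathfrak{D}_iF\,\mathfrak{D}_i\mathbf{1}_{\{F>x\}}+E_i\big[\mathfrak{D}_iF\,\mathfrak{D}_i\mathbf{1}_{\{F>x\}}\big]\Big)\big|E[\mathfrak{D}_iF|\mathcal{F}_i]\big|\right],$$ $$B_2:=E\left[\sum_{i=1}^{\infty}\Big(|F|+\frac{\sqrt{2\pi}}{4}\Big)(\mathfrak{d}_iF)^2\,\big|E[\mathfrak{D}_iF|\mathcal{F}_i]\big|\right].$$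
   Context: $X=(X_1,X_2,\dots)$ is a sequence of independent random variables (not necessarily identically distributed) on a probability space $(\Omega,\mathfrak{F},P)$ with values in a measurable space $\mathcal{X}$. $F=F(X)$ means that $F$ is a real-valued measurable function of the sequence $X$. $X'=(X_1',X_2',\dots)$ is an independent copy of $X$, and $T_iF=F(X_1,\dots,X_{i-1},X_i',X_{i+1},\dots)$ for $i\ge1$. $E_i$ and $E_i'$ denote the expectations with respect to $X_i$ and $X_i'$, respectively; in particular $E_i[F]=E[F|\sigma(X_k,k\neq i)]$. Difference operators: $\mathfrak{D}_iF=F-E_i[F]$ for $F\in L^1(P)$, and $\mathfrak{d}_iF=\big(\tfrac12E_i'|F-T_iF|^2\big)^{1/2}$ for $F\in L^2(P)$, $i\ge1$. $\mathcal{F}_i=\sigma(X_k,k\le i)$ for $i\ge1$. $\mathbf{1}_{\{F>x\}}$ is the indicator of the event $\{F>x\}$. $N$ is a standard normal random variable and $d_K(F,N)=\sup_{x\in\mathbb{R}}|P(F\le x)-P(N\le x)|$.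
   Formalization: The series defining Z need not converge for a general F in L²(P); the formal theorem assumes in addition that it converges in L¹(P) and takes Z to be its L¹ sum. *)

(* Defs.v *)
From HB Require Import structures.
From mathcomp Require Import all_boot all_order all_algebra finmap.
From mathcomp Require Import all_classical all_reals all_analysis.

Set Implicit Arguments.
Unset Strict Implicit.
Unset Printing Implicit Defensive.

Import Order.TTheory GRing.Theory Num.Theory.
Import numFieldNormedType.Exports.

Local Open Scope classical_set_scope.
Local Open Scope ring_scope.

Definition mutually_independent (R : realType) d (T : measurableType d)
    (P : probability T R) d' (S : measurableType d')
    (X : nat -> {RV P >-> S}) : Prop :=
  forall (J : {fset nat}) (A : nat -> set S),
    (forall j, j \in J -> measurable (A j)) ->
    P (\bigcap_(j in [set` J]) (X j @^-1` A j)) =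
    (\prod_(j <- J) P (X j @^-1` A j))%E.

(* <<s generators D Y >> is the sigma-algebra sigma(Y_k, k \in D). *)
Definition generators (aT : Type) d' (S : measurableType d')
    (D : set nat) (Y : nat -> aT -> S) : set (set aT) :=
  \bigcup_(k in D) preimage_set_system setT (Y k) measurable.

(* Measurability with respect to the product sigma-algebra on S^nat. *)
Definition measurable_functional d' (S : measurableType d') (R : realType)
    (f : (nat -> S) -> R) : Prop :=
  measurable_fun setT
    (f : g_sigma_algebraType (generators setT (fun k (x : nat -> S) => x k)) ->
         R).

(* C is a version of E[H | <<s G >>]. *)
Definition is_cond_expectation (R : realType) d (T : measurableType d)
    (P : probability T R) (G : set (set T)) (H C : T -> R) : Prop :=
  [/\ measurable_fun setT (C : g_sigma_algebraType G -> R),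
      P.-integrable setT (EFin \o C) &
      forall A, <<s G >> A ->
        (\int[P]_(w in A) (C w)%:E = \int[P]_(w in A) (H w)%:E)%E].

(* Functionals F(X) are handled through the function f on S^nat such that
   F = f(X_0, X_1, ...); the indices start at 0. *)
Section difference_operators.
Context (R : realType) d (T : measurableType d) (P : probability T R)
  d' (S : measurableType d') (X : nat -> {RV P >-> S}).
Implicit Types (f : (nat -> S) -> R) (x : nat -> S).

(* If X' is an independent copy of X, T_i F is resample i f X (X'_i). *)
Definition resample (i : nat) f x (y : S) : R := f [eta x with i |-> y].

Definition E_ (i : nat) f x : R :=
  \int[distribution P (X i)]_y resample i f x y.

Definition D_ (i : nat) f x : R := f x - E_ i f x.

(* The expectation E'_i only involves the law of X'_i, which is that of X_i. *)
Definition d_ (i : nat) f x : R :=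
  Num.sqrt (2^-1 *
    \int[distribution P (X i)]_y (`|f x - resample i f x y| ^+ 2)).

(* The functional whose value at X is the indicator of {F > t}. *)
Definition ind_gt f (t : R) : (nat -> S) -> R := \1_[set x | t < f x].

Definition sample_path (w : T) : nat -> S := fun k => X k w.

(* In B1 and B2, C i stands for E[D_i F | F_i]. The terms of both series are
   almost surely nonnegative. *)
Definition B1 f (C : nat -> T -> R) : \bar R :=
  ereal_sup [set
    (\int[P]_w \sum_(0 <= i <oo)
      ((D_ i f (sample_path w) * D_ i (ind_gt f t) (sample_path w) +
        E_ i (fun x => D_ i f x * D_ i (ind_gt f t) x)%R (sample_path w))
       * `|C i w|)%R%:E)%E | t in [set: R]].

Definition B2 f (C : nat -> T -> R) : \bar R :=
  (\int[P]_w \sum_(0 <= i <oo)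
    ((`|f (sample_path w)| + Num.sqrt (2 * pi) / 4) * d_ i f (sample_path w) ^+ 2
     * `|C i w|)%R%:E)%E.

End difference_operators.

(* Z is the sum of the series of general term u i, in the sense of L^1(P). *)
Definition L1_sum (R : realType) d (T : measurableType d)
    (P : probability T R) (u : nat -> T -> R) (Z : T -> R) : Prop :=
  Z \in Lfun P 1%E /\
  ('E_P[fun w => `|\sum_(0 <= i < n) u i w - Z w|%R])%E @[n --> \oo] --> 0%E.

Definition d_K (R : realType) d (T : measurableType d) (P : probability T R)
    d0 (T0 : measurableType d0) (Q : probability T0 R)
    (F : {RV P >-> R}) (N : {RV Q >-> R}) : \bar R :=
  ereal_sup [set `|cdf F t - cdf N t|%E | t in [set: R]].

Definition standard_normal (R : realType) d (T : measurableType d)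
    (Q : probability T R) (N : {RV Q >-> R}) : Prop :=
  forall A : set R, measurable A -> distribution Q N A = normal_prob 0 1 A.

(* Main.v *)
(* Stein's method.  For the solution g of Stein's equation at t,
   P(F <= t) - P(N <= t) = E[g'(F)] - E[F g(F)].  Write M_i = E[D_i F | F_i];
   these are the martingale differences of E[F | F_i], so that
   E[F g(F)] = sum_i E[M_i g(F)] = sum_i E[M_i D_i g(F)].  A first-order
   expansion of g around F turns D_i g(F) into g'(F) D_i F, up to
   an error controlled by the terms of B1 (the jump of g' at t) and B2
   (the Lipschitz part of g').  Hence E[F g(F)] is E[g'(F) Z] up to B1 + B2,
   and |g'| <= 1 gives the first inequality.  The same formula with F in place
   of g(F) gives E[Z] = E[F^2], hence the second inequality.

   Conditional expectations given (X_k, k in D) are integrals over an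
   independent copy of the coordinates outside D. *)

From HB Require Import structures.
Require Import Defs.
From mathcomp Require Import all_boot all_order all_algebra finmap.
From mathcomp Require Import all_classical all_reals all_analysis.
From mathcomp Require Import measurable_realfun ring lra.

Set Implicit Arguments.
Unset Strict Implicit.
Unset Printing Implicit Defensive.

Import Order.TTheory GRing.Theory Num.Theory.
Import numFieldNormedType.Exports.
Local Open Scope classical_set_scope.
Local Open Scope ring_scope.

(** The bracket in [B1] comes from an identity: for two functionals, the product of their [D_i] plus
    the [E_i] of this product equals the integral, over a fresh value of [X_i], of the product of
    their two changes. For [F] and the indicator of [F > t] both changes have the same sign; their
    product is nonnegative and dominates the effect of the jump of [g']. The factor 1/2 in
    [(d_i F)^2] is that of a second-order Taylor error, and the weight [|F| + sqrt(2 pi) / 4] is a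
    Lipschitz constant of [w g(w)] around [F], obtained from [|g'| <= 1] and
    [0 <= g <= sqrt(2 pi) / 4]. Convergence shapes the proof: the series for [E[F g(F)]] converges
    as a series of numbers, the one for [Z] in L1, and [B1], [B2] may be infinite. Errors are
    therefore compared on partial sums, with a bound uniform in the number of terms, and the limit
    is taken last. Since [g'(F)] is bounded, L1 convergence to [Z] survives multiplication by it. *)

Section piecewise.
Context {R : realType}.
Implicit Types (f df : R -> R) (a b : R).

Lemma is_deriveC (x c : R) : is_derive x 1 (fun=> c) 0.
Proof. exact: is_derive_cst. Qed.

Lemma is_derive_idfun (x : R) : is_derive x 1 (fun y : R => y) 1.
Proof. exact: is_derive_id. Qed.

Lemma is_derive_add f g (x a b : R) : is_derive x 1 f a -> is_derive x 1 g b ->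
  is_derive x 1 (fun y => f y + g y) (a + b).
Proof. by move=> fa gb; exact: is_deriveD. Qed.

Lemma is_derive_opp f (x a : R) : is_derive x 1 f a ->
  is_derive x 1 (fun y => - f y) (- a).
Proof. by move=> fa; exact: is_deriveN. Qed.

Lemma is_derive_mul f g (x a b : R) : is_derive x 1 f a -> is_derive x 1 g b ->
  is_derive x 1 (fun y => f y * g y) (f x * b + g x * a).
Proof. by move=> fa gb; exact: is_deriveM. Qed.

Lemma is_derive_expr2 f (x a : R) : is_derive x 1 f a ->
  is_derive x 1 (fun y => f y ^+ 2) (2 * f x * a).
Proof.
move=> fa; rewrite (_ : (fun y => _) = fun y => f y * f y); last first.
  by apply/funext => y; rewrite expr2.
apply: (is_derive_eq (is_derive_mul fa fa)).
by rewrite -mulrA mulr2n mulrDl mul1r.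
Qed.

Lemma is_derive_exp f (x a : R) : is_derive x 1 f a ->
  is_derive x 1 (fun y => expR (f y)) (expR (f x) * a).
Proof. by move=> fa; exact: is_derive1_comp. Qed.

Lemma is_derive_cont f df : (forall x : R, is_derive x 1 f (df x)) -> continuous f.
Proof.
move=> fd x; apply: differentiable_continuous; apply/derivable1_diffP.
by have [] := fd x.
Qed.

Lemma is_derive_ge0_le f df a b : (forall x : R, is_derive x 1 f (df x)) ->
  a <= b -> (forall x, a < x < b -> 0 <= df x) -> f a <= f b.
Proof.
move=> fd; rewrite le_eqVlt => /predU1P[->//|ab] df0.
have [|c cab e] := @MVT R f df a b ab (fun x _ => fd x).
  by apply: continuous_subspaceT; exact: is_derive_cont fd.
by rewrite -subr_ge0 e mulr_ge0 ?subr_ge0 ?(ltW ab)// df0// -in_itv.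
Qed.

(** The glued function may have a kink at [x], where the mean value theorem does not apply; the two
    monotone pieces are chained through their common value at [x] instead. *)
Lemma piecewise_le x f g df dg a b : f x = g x ->
  (forall y : R, is_derive y 1 f (df y)) -> (forall y : R, is_derive y 1 g (dg y)) ->
  a <= b ->
  (forall y, a < y < b -> y <= x -> 0 <= df y) ->
  (forall y, a < y < b -> x < y -> 0 <= dg y) ->
  (if a <= x then f a else g a) <= (if b <= x then f b else g b).
Proof.
move=> fgx fd gd ab f0 g0; case: (leP a x) => ax; case: (leP b x) => bx.
- by apply: (is_derive_ge0_le fd ab) => y /[dup] yab /andP[_ yb]; apply: f0 => //; lra.
- apply: (@le_trans _ _ (f x)); last rewrite fgx.
    by apply: (is_derive_ge0_le fd ax) => y ?; apply: f0; lra.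
  by apply: (is_derive_ge0_le gd (ltW bx)) => y ?; apply: g0; lra.
- lra.
- by apply: (is_derive_ge0_le gd ab) => y /[dup] yab /andP[ya _]; apply: g0 => //; lra.
Qed.

End piecewise.

(* [notypeclasses]: the library instances would produce [_ *: _] in [R^o]. *)
Ltac derive1 := notypeclasses refine (is_derive_eq _ _);
  [repeat first [notypeclasses refine (is_deriveC _ _)
     | notypeclasses refine (is_derive_idfun _) | eassumption
     | notypeclasses refine (is_derive_add _ _)
     | notypeclasses refine (is_derive_opp _)
     | notypeclasses refine (is_derive_expr2 _)
     | notypeclasses refine (is_derive_exp _)
     | notypeclasses refine (is_derive_mul _ _)] | rewrite /=].

(** * The standard normal distribution function *)

Section normal_cdf.
Context {R : realType}.
Implicit Types x w : R.

Let phi : R -> R := normal_pdf 0 1.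
Let s : R := Num.sqrt (2 * pi).

Definition Phi x : R := fine (@normal_prob R 0 1 `]-oo, x]).

Lemma sqrt2pi_gt0 : 0 < s.
Proof. by rewrite sqrtr_gt0 mulr_gt0// pi_gt0. Qed.

Lemma normal_pdf01E x : phi x = s^-1 * expR (- (x ^+ 2 / 2)).
Proof.
rewrite /phi normal_pdfE ?oner_neq0// /normal_peak /normal_fun.
rewrite subr0 expr1n mul1r mulNr; congr (_^-1 * expR _).
by rewrite /s -mulr_natl.
Qed.

Lemma is_derive_Phi x : is_derive x 1 Phi (phi x).
Proof.
have [] := @continuous_FTC1 R phi -oo%O x (x + 1).
- by rewrite ltrDl.
- exact: integrableS (@integrable_normal_pdf R 0 1).
- by rewrite ltNyr.
- by apply: continuous_normal_pdf; exact: oner_neq0.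
rewrite derive1E => d1 d2; exact: DeriveDef.
Qed.

Hint Resolve is_derive_Phi : core.

Lemma Phi_ge0 x : 0 <= Phi x.
Proof. exact: fine_ge0. Qed.

Lemma Phi_le1 x : Phi x <= 1.
Proof.
rewrite /Phi -lee_fin fineK ?fin_num_measure//; exact: probability_le1.
Qed.

Lemma Phi_mono x w : x <= w -> Phi x <= Phi w.
Proof.
move=> xw; apply: (is_derive_ge0_le is_derive_Phi xw) => y _.
exact: normal_pdf_ge0.
Qed.

(** Under [normal_prob 0 1] the identity is a random variable whose distribution function gives
    [Phi]; this brings the limits of [cdf] to [Phi]. *)
Let idTR : measurableTypeR R -> R := idfun.

#[local] HB.instance Definition _ :=
  @isMeasurableFun.Build _ _ _ _ idTR (@measurable_id _ _ setT).

Lemma cvg_Phi : Phi w @[w --> +oo%R] --> (1 : R) /\ Phi w @[w --> -oo%R] --> (0 : R).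
Proof.
pose X : {RV (normal_prob 0 1 : probability _ R) >-> R} := idTR.
split.
  apply: (@fine_cvg _ _ _ _ (cdf X)). exact: cvg_cdfy1.
apply: (@fine_cvg _ _ _ _ (cdf X)); exact: cvg_cdfNy0.
Qed.

(** A far point with a small tail stands in for the limit at infinity in the two arguments by
    contradiction below. *)
Lemma Phi_tail x e : 0 < e -> exists2 w, x <= w & 1 - Phi w < e.
Proof.
move=> e0; have [/cvgr_gt/(_ (1 - e)) + _] := cvg_Phi.
rewrite ltrBlDr ltrDl => /(_ e0) h.
have [w [/= h1 h2]] := filter_ex (filterI h (nbhs_pinfty_ge (num_real x))).
by exists w => //; lra.
Qed.

Lemma is_derive_gauss x :
  is_derive x 1 (fun w : R => expR (- (w ^+ 2 / 2))) (- x * expR (- (x ^+ 2 / 2))).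
Proof. by derive1; field. Qed.

Lemma is_derive_phi x : is_derive x 1 phi (- x * phi x).
Proof.
rewrite (_ : phi = fun w => s^-1 * expR (- (w ^+ 2 / 2))); last first.
  by apply/funext => w; exact: normal_pdf01E.
have := is_derive_gauss x => ?; derive1; ring.
Qed.

(** The density is even, so [Phi w + Phi (- w)] has derivative 0; its constant value is read off at
    infinity. *)
Lemma PhiN x : Phi (- x) = 1 - Phi x.
Proof.
pose h w := Phi w + Phi (- w).
have hd w : is_derive w 1 h 0.
  have d := is_derive_opp (is_derive_idfun w).
  apply: (is_derive_eq (is_derive_add (is_derive_Phi w)
    (@is_derive1_comp _ Phi _ _ _ _ (is_derive_Phi (- w)) d))).
  by rewrite !normal_pdf01E sqrrN; ring.
have hc w : h w = h x by exact: is_derive_0_is_cst.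
have [h1 h0] := @cvg_Phi.
have hl : h w @[w --> +oo%R] --> (1 + 0 : R).
  by apply: cvgD => //; apply/(cvgNy_compNP Phi).
suff : h x = 1 + 0 by rewrite /h; lra.
have e : h = cst (h x) by apply/funext => w; exact: hc.
have hx : h w @[w --> +oo%R] --> h x by rewrite [X in X w @[w --> _]]e; exact: cvg_cst.
exact: (cvg_unique _ hx hl).
Qed.

(** With [x] frozen, [k y = x * (1 - Phi y) - phi y] increases on [[x, +oo[] and tends to 0. A
    positive [k x] would exceed [k w] for a far [w]; the denominator [x + 1] keeps the tail
    threshold well defined at [x = 0]. *)
Lemma mills x : 0 <= x -> x * (1 - Phi x) <= phi x.
Proof.
move=> x0; rewrite leNgt; apply/negP => h.
have x1 : 0 < x + 1 by lra.
have e0 : 0 < (x * (1 - Phi x) - phi x) / (x + 1) by rewrite divr_gt0//; lra.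
have [w xw] := Phi_tail x e0.
rewrite ltr_pdivlMr// => hw.
pose k y := x * (1 - Phi y) - phi y.
have kd (y : R) : is_derive y 1 k ((y - x) * phi y).
  have := is_derive_Phi y; have := is_derive_phi y => ? ?.
  by derive1; ring.
have : k x <= k w.
  apply: (is_derive_ge0_le kd xw) => y /andP[xy _].
  by rewrite mulr_ge0 ?normal_pdf_ge0// subr_ge0 ltW.
have := @normal_pdf_ge0 R 0 1 w; rewrite -/(phi w) /k.
have := Phi_le1 w; nra.
Qed.

(* On [0, +oo[, the difference of the two sides vanishes at 0 and at infinity and
   its derivative has the sign of a convex function vanishing at 0. *)
Lemma Phi_var_le x : Phi x * (1 - Phi x) <= expR (- (x ^+ 2 / 2)) / 4.
Proof.
wlog x0 : x / 0 <= x.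
  move=> h; have [/h//|/ltW x0] := leP 0 x.
  have := h (- x); rewrite oppr_ge0 sqrrN PhiN => /(_ x0); lra.
have s0 := sqrt2pi_gt0.
pose q w := Phi w * (1 - Phi w) - expR (- (w ^+ 2 / 2)) / 4.
pose b w := (1 - 2 * Phi w) / s + w / 4.
have qd (w : R) : is_derive w 1 q (expR (- (w ^+ 2 / 2)) * b w).
  have := is_derive_Phi w; have := is_derive_gauss w => ? ?.
  by derive1; rewrite normal_pdf01E /b; field; rewrite gt_eqF.
have bd (w : R) : is_derive w 1 b (4^-1 - 2 * phi w / s).
  have := is_derive_Phi w => ?.
  by derive1; field; rewrite gt_eqF.
have P0 : Phi 0 = 2^-1 by have := PhiN 0; rewrite oppr0; lra.
have q0 : q 0 = 0 by rewrite /q P0 expr0n mul0r oppr0 expR0; lra.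
have b0 : b 0 = 0 by rewrite /b P0; lra.
suff : q x <= 0 by rewrite /q; lra.
(* If [q x > 0], the mean value theorem gives [b c > 0] with [c < x], then a positive derivative of
   [b] at some [t < c]. That derivative increases on [[0, +oo[], so [b] stays positive beyond [c]
   and [q] increases beyond [x], although [q] is at most the tail [1 - Phi]. *)
rewrite leNgt; apply/negP => qx.
have {}x0 : 0 < x by rewrite lt_neqAle x0 andbT; apply/eqP => e; move: qx; rewrite -e q0 ltxx.
have [|c] := @MVT R q _ 0 x x0 (fun w _ => qd w).
  by apply: continuous_subspaceT; exact: is_derive_cont qd.
rewrite in_itv/= => /andP[c0 cx]; rewrite q0 !subr0 => qe.
have bc : 0 < b c by move: qx; rewrite qe pmulr_lgt0// pmulr_rgt0// expR_gt0.
have [|t] := @MVT R b _ 0 c c0 (fun w _ => bd w).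
  by apply: continuous_subspaceT; exact: is_derive_cont bd.
rewrite in_itv/= => /andP[t0 tc]; rewrite b0 !subr0 => be.
have bt : 0 < 4^-1 - 2 * phi t / s by move: bc; rewrite be pmulr_lgt0.
have bge y : c <= y -> 0 < b y.
  move=> cy; apply: (lt_le_trans bc); apply: (is_derive_ge0_le bd cy) => z /andP[cz _].
  apply: (le_trans (ltW bt)); rewrite lerD2l lerN2 ler_pM2r ?invr_gt0//.
  rewrite ler_pM2l// !normal_pdf01E ler_pM2l ?invr_gt0// ler_expR; nra.
have [w xw] := Phi_tail x qx.
have : q x <= q w.
  apply: (is_derive_ge0_le qd xw) => y /andP[xy _].
  by rewrite mulr_ge0 ?expR_ge0// ltW// bge//; lra.
rewrite {2}/q; have := expR_gt0 (- (w ^+ 2 / 2)).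
have := Phi_ge0 w; have := Phi_le1 w; nra.
Qed.
End normal_cdf.

(** * Stein's equation *)

Section stein.
Context {R : realType}.
Variable x : R.
Implicit Types a b w : R.

Let phi : R -> R := normal_pdf 0 1.
Let s : R := Num.sqrt (2 * pi).
Let e w := expR (w ^+ 2 / 2).

(** The factor [s * e w] is [1 / phi w]. Both closed forms are smooth on the whole line, so each can
    be differentiated at [x] as well. *)
Let gl w := s * e w * Phi w * (1 - Phi x).
Let gr w := s * e w * Phi x * (1 - Phi w).

(* The solution of Stein's equation [g' w - w * g w = (w <= x) - Phi x]. *)
Definition stein w := if w <= x then gl w else gr w.

Let s0 : 0 < s. Proof. exact: sqrt2pi_gt0. Qed.

Let e0 w : 0 < e w. Proof. exact: expR_gt0. Qed.

Let ephi w : s * e w * phi w = 1.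
Proof.
rewrite /phi normal_pdf01E mulrAC mulrA divff ?gt_eqF//.
by rewrite mul1r mulrC -expRD subrr expR0.
Qed.

Let e_derive w : is_derive w 1 e (w * e w).
Proof. by derive1; rewrite /e; field. Qed.

Let gl_derive w : is_derive w 1 gl (w * gl w + (1 - Phi x)).
Proof.
have := e_derive w; have := is_derive_Phi w => ? ?.
derive1; rewrite -/phi /gl.
by have := ephi w; set p := phi w => h; ring: h.
Qed.

Let gr_derive w : is_derive w 1 gr (w * gr w - Phi x).
Proof.
have := e_derive w; have := is_derive_Phi w => ? ?.
derive1; rewrite -/phi /gr.
by have := ephi w; set p := phi w => h; ring: h.
Qed.

Let gx : gl x = gr x.
Proof. by rewrite /gl /gr; ring. Qed.

Lemma stein_ge0 w : 0 <= stein w.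
Proof.
have ? := Phi_ge0 x; have ? := Phi_ge0 w; have ? := Phi_le1 x.
have ? := Phi_le1 w; have ? := s0; have ? := e0 w.
have h : 0 <= s * e w by rewrite mulr_ge0// ltW.
by rewrite /stein /gl /gr; case: (leP w x) => _; (apply: mulr_ge0; [exact: mulr_ge0 | lra]).
Qed.

(** Monotonicity of [Phi] allows [x] to be replaced by [w] in the product of the two tails;
    [Phi_var_le] then cancels [e w] and leaves the constant [sqrt(2 pi) / 4]. *)
Lemma stein_le w : stein w <= s / 4.
Proof.
have ? := Phi_ge0 x; have ? := Phi_ge0 w; have ? := Phi_le1 x.
have ? := Phi_le1 w; have ? := s0; have ? := e0 w.
have h : s * e w * (Phi w * (1 - Phi w)) <= s / 4.
  rewrite -mulrA ler_pM2l//.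
  rewrite (le_trans (ler_wpM2l (ltW (e0 w)) (Phi_var_le w)))//.
  by rewrite mulrA /e -expRD subrr expR0 mul1r.
apply: le_trans h; rewrite /stein /gl /gr -!mulrA.
case: (leP w x) => wx; rewrite ler_pM2l// ler_pM2l//.
  by rewrite ler_wpM2l//; have := Phi_mono wx; lra.
by rewrite ler_wpM2r//; have := Phi_mono (ltW wx); lra.
Qed.

Let mills_ge w : 0 <= w -> w * (s * e w * (1 - Phi w)) <= 1.
Proof.
move=> w0; rewrite -[leRHS](ephi w) mulrCA ler_pM2l ?mulr_gt0//.
exact: mills.
Qed.

Let mills_le w : w <= 0 -> - w * (s * e w * Phi w) <= 1.
Proof.
move=> w0; have := @mills_ge (- w); rewrite PhiN /e sqrrN opprB addrCA subrr addr0.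
by apply; lra.
Qed.

(** This is the derivative of [gl], factored as [(w * Phi w / phi w + 1) * (1 - Phi x)]. For [w < 0]
    Mills' bound puts the first factor in [[0, 1]]. For [0 <= w] the second factor is at most
    [1 - Phi w], and Mills' bound leaves [Phi w + (1 - Phi w) = 1]. *)
Let gl_bound w : w <= x -> 0 <= w * gl w + (1 - Phi x) <= 1.
Proof.
move=> wx; have ? := Phi_mono wx; have ? := Phi_ge0 x; have ? := Phi_ge0 w.
have ? := Phi_le1 x; have ? := Phi_le1 w; have h := mulr_gt0 s0 (e0 w).
have hp : 0 <= s * e w * Phi w by rewrite mulr_ge0// ltW.
rewrite (_ : _ + _ = (w * (s * e w * Phi w) + 1) * (1 - Phi x)); last by rewrite /gl; ring.
have [w0|w0] := leP 0 w.
  have hw : 0 <= w * (s * e w * Phi w) by exact: mulr_ge0.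
  have := mills_ge w0.
  move: h hp hw; set k := s * e w => h hp hw hm.
  apply/andP; split; first by rewrite mulr_ge0//; lra.
  have h1 : (w * (k * Phi w) + 1) * (1 - Phi x) <= (w * (k * Phi w) + 1) * (1 - Phi w).
    by rewrite ler_wpM2l//; lra.
  apply: (le_trans h1); have : w * (k * (1 - Phi w)) * Phi w <= 1 * Phi w by rewrite ler_wpM2r.
  by nra.
have := mills_le (ltW w0); have hw : 0 <= - w * (s * e w * Phi w) by rewrite mulr_ge0//; lra.
by move: hw; set k := w * _; rewrite mulNr -/k => ? ?; apply/andP; split; nra.
Qed.

Let gr_bound w : x <= w -> -1 <= w * gr w - Phi x <= 0.
Proof.
move=> wx; have ? := Phi_mono wx; have ? := Phi_ge0 x; have ? := Phi_ge0 w.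
have ? := Phi_le1 x; have ? := Phi_le1 w; have h := mulr_gt0 s0 (e0 w).
have hp : 0 <= s * e w * (1 - Phi w) by rewrite mulr_ge0 ?subr_ge0// ltW.
rewrite (_ : _ - _ = (w * (s * e w * (1 - Phi w)) - 1) * Phi x); last by rewrite /gr; ring.
have [w0|w0] := leP 0 w.
  have hw : 0 <= w * (s * e w * (1 - Phi w)) by exact: mulr_ge0.
  have := mills_ge w0; move: hw; set k := w * _ => ? ?.
  by apply/andP; split; nra.
have hw : 0 <= - w * (s * e w * (1 - Phi w)) by rewrite mulr_ge0//; lra.
have := mills_le (ltW w0).
move: h hp hw; set k := s * e w => h hp hw hm.
apply/andP; split; last by rewrite mulr_le0_ge0//; lra.
have h1 : (- w * (k * (1 - Phi w)) + 1) * Phi x <= (- w * (k * (1 - Phi w)) + 1) * Phi w.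
  by rewrite ler_wpM2l//; lra.
have : - w * (k * Phi w) * (1 - Phi w) <= 1 * (1 - Phi w) by rewrite ler_wpM2r//; lra.
by nra.
Qed.

(* The derivative of [stein], with the value of the left derivative at [x]. *)
Definition dstein w := w * stein w + (w <= x)%R%:R - Phi x.

Lemma dstein_le1 w : `|dstein w| <= 1.
Proof.
rewrite /dstein /stein ler_norml; case: (leP w x) => wx.
  by have := gl_bound wx; move: (w * gl w) => k /=; lra.
by have := gr_bound (ltW wx); move: (w * gr w) => k /=; lra.
Qed.

(** Every estimate on increments of [stein] is read as monotonicity after adding a smooth [p], with
    [c] of either sign. The term [k * Num.min w x] has slope [k] left of [x] and 0 right of it:
    [k = 0] serves the Lipschitz bound, and [k = 1] cancels the jump of [dstein]. *)
Let stein_derive_le (c k : R) (p dp : R -> R) a b :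
  (forall y : R, is_derive y 1 p (dp y)) -> a <= b ->
  (forall y, a < y < b -> 0 <= dp y + c * (dstein y - k * (y <= x)%R%:R)) ->
  p a + c * (stein a - k * Num.min a x) <= p b + c * (stein b - k * Num.min b x).
Proof.
move=> pd ab h.
pose f w := p w + c * (gl w - k * w); pose g w := p w + c * (gr w - k * x).
have E w : p w + c * (stein w - k * Num.min w x) = if w <= x then f w else g w.
  by rewrite /stein minEle /f /g; case: ifP.
have fd (y : R) : is_derive y 1 f (dp y + c * (y * gl y + (1 - Phi x) - k)).
  have := pd y; have := gl_derive y => ? ?; derive1.
  by move: (gl y) (dp y) (Phi x) => u v w; ring.
have gd (y : R) : is_derive y 1 g (dp y + c * (y * gr y - Phi x)).
  have := pd y; have := gr_derive y => ? ?; derive1.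
  by move: (gr y) (dp y) (Phi x) => u v w; ring.
rewrite !E; apply: (piecewise_le _ fd gd ab) => [|y yab yx|y yab yx].
- by rewrite /f /g gx.
- have := h y yab; rewrite /dstein /stein yx mulr1.
  by congr (_ <= _ + _ * _); move: (gl y) => u /=; ring.
- have := h y yab; rewrite /dstein /stein [y <= x]leNgt yx/=.
  by rewrite mulr0 subr0 addr0.
Qed.

(** Both [w + stein w] and [w - stein w] are nondecreasing, since [dstein] lies in [[-1, 1]]. *)
Lemma stein_lip a b : `|stein b - stein a| <= `|b - a|.
Proof.
wlog ab : a b / a <= b.
  by move=> h; have [/h//|/ltW/h] := leP a b; rewrite distrC (distrC b).
have dp (y : R) : is_derive y 1 (fun w : R => w) 1 by exact: is_derive_idfun.
have := fun c h => @stein_derive_le c 0 _ _ a b dp ab h.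
move=> h; have h1 := h 1; have {h}h2 := h (-1).
rewrite (ger0_norm (x := b - a)) ?subr_ge0// ler_norml.
move: h1 h2; rewrite !mul0r !subr0 => h1 h2.
have {}h1 : a + 1 * stein a <= b + 1 * stein b.
  by apply: h1 => y _; have := dstein_le1 y; rewrite ler_norml; lra.
have {}h2 : a + -1 * stein a <= b + -1 * stein b.
  by apply: h2 => y _; have := dstein_le1 y; rewrite ler_norml; lra.
by lra.
Qed.

(** The increment splits as [a * (stein b - stein a) + stein b * (b - a)]; the Lipschitz and uniform
    bounds on [stein] produce the weight that appears in [B2]. *)
Lemma mul_stein_lip a b :
  `|b * stein b - a * stein a| <= (`|a| + s / 4) * `|b - a|.
Proof.
rewrite (_ : _ - _ = a * (stein b - stein a) + stein b * (b - a)); last by ring.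
rewrite (le_trans (ler_normD _ _))// mulrDl lerD// normrM.
  by rewrite ler_wpM2l// stein_lip.
by rewrite ler_wpM2r// ger0_norm ?stein_ge0// stein_le.
Qed.

(* Subtracting [min w x] removes the kink of [stein] at [x]. *)
Let stein_quadratic a b :
  `|(stein b - Num.min b x) - (stein a - Num.min a x) - (a * stein a - Phi x) * (b - a)|
   <= (`|a| + s / 4) * (b - a) ^+ 2 / 2.
Proof.
set K := `|a| + s / 4; set c0 := a * stein a - Phi x.
have pd (c d y : R) : is_derive y 1
    (fun w : R => c * K * (w - a) ^+ 2 / 2 - d * c0 * (w - a)) (c * K * (y - a) - d * c0).
  derive1; by clearbody K c0; field.
have dE y : dstein y - 1 * (y <= x)%R%:R = c0 + (y * stein y - a * stein a).
  by rewrite /dstein /c0; move: (stein y) (stein a) => u v; lra.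
have bd y : `|y * stein y - a * stein a| <= K * `|y - a| by exact: mul_stein_lip.
(* Here [c] is the sign of [y - a] on the interval and [d] selects one half of the two-sided bound;
   four instances cover both orders of [a] and [b]. The quadratic term is a primitive of the
   Lipschitz bound [K * |y - a|]. *)
have D (c d u v : R) : u <= v -> `|d| = 1 ->
    (forall y, u < y < v -> c * (y - a) = `|y - a|) ->
    c * K * (u - a) ^+ 2 / 2 - d * c0 * (u - a) + d * (stein u - Num.min u x) <=
    c * K * (v - a) ^+ 2 / 2 - d * c0 * (v - a) + d * (stein v - Num.min v x).
  move=> uv d1 hc; have := @stein_derive_le d 1 _ _ u v (pd c d) uv.
  rewrite !mul1r; apply=> y yuv; rewrite dE.
  have := bd y; rewrite -(hc _ yuv) -[leLHS]mul1r -d1 -normrM ler_norml => /andP[+ _].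
  by move: (y * _ - _) => t; clearbody K c0; nra.
clearbody K c0; rewrite ler_norml.
have [ab|/ltW ba] := leP a b.
- have h y : a < y < b -> 1 * (y - a) = `|y - a|.
    by move=> /andP[ay _]; rewrite mul1r ger0_norm// subr_ge0 ltW.
  have := D 1 1 a b ab (normr1 _) h; have := D 1 (-1) a b ab (normrN1 _) h.
  by move: (stein a - _) (stein b - _) => u v; lra.
- have h y : b < y < a -> -1 * (y - a) = `|y - a|.
    by move=> /andP[_ ya]; rewrite mulN1r ler0_norm// subr_le0 ltW.
  have := D (-1) 1 b a ba (normr1 _) h; have := D (-1) (-1) b a ba (normrN1 _) h.
  by move: (stein a - _) (stein b - _) => u v; lra.
Qed.

(** The kink is put back: the first-order error of [Num.min w x] vanishes unless [x] separates [a]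
    and [b], and is then at most [|b - a|], the value of the product on the right. That product is
    the source of [B1], the quadratic term that of [B2]. *)
Lemma stein_taylor a b :
  `|stein b - stein a - dstein a * (b - a)| <=
  (`|a| + s / 4) * (b - a) ^+ 2 / 2 + (b - a) * ((x < b)%R%:R - (x < a)%R%:R).
Proof.
have := stein_quadratic a b.
have -> : stein b - stein a - dstein a * (b - a) =
  ((stein b - Num.min b x) - (stein a - Num.min a x) - (a * stein a - Phi x) * (b - a))
  + (Num.min b x - Num.min a x - (a <= x)%R%:R * (b - a)).
  by rewrite /dstein; move: (stein a) (stein b) (Num.min a x) (Num.min b x) => u v w z; ring.
move: (_ * _ / 2) (_ - _ - (_ - Phi x) * _) => B A AB.
apply: (le_trans (ler_normD _ _)); apply: lerD => //.
rewrite !minEle ler_norml.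
by case: (leP a x) => ax; case: (leP b x) => bx /=; nra.
Qed.

Lemma measurable_stein : measurable_fun [set: R] stein.
Proof.
apply: measurable_fun_ifT.
- by apply: measurable_fun_ler => //; exact: measurable_cst.
- by apply: continuous_measurable_fun; exact: is_derive_cont gl_derive.
- by apply: continuous_measurable_fun; exact: is_derive_cont gr_derive.
Qed.

Lemma measurable_dstein : measurable_fun [set: R] dstein.
Proof.
apply: measurable_funB => //; apply: measurable_funD.
  by apply: measurable_funM => //; exact: measurable_stein.
rewrite (_ : (fun w => _) = fun w => if w <= x then 1 else 0).
  by apply: measurable_fun_ifT => //; apply: measurable_fun_ler.
by apply/funext => w; case: (w <= x).
Qed.

End stein.

Notation intg mu f := ((mu).-integrable setT (EFin \o f)).

(** * Integrable and square-integrable functions *)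

Section integrable_real.
Context d (T : measurableType d) (R : realType) (mu : probability T R).
Implicit Types (f g u v : T -> R) (A : set T).

Lemma intg_measurable f : intg mu f -> measurable_fun setT f.
Proof. by move=> /integrableP[/measurable_EFinP]. Qed.

Lemma intgD f g : intg mu f -> intg mu g -> intg mu (fun x => f x + g x).
Proof. by move=> fi gi; exact: (integrableD measurableT fi gi). Qed.

Lemma intgB f g : intg mu f -> intg mu g -> intg mu (fun x => f x - g x).
Proof. by move=> fi gi; exact: (integrableB measurableT fi gi). Qed.

Lemma intgZ (c : R) f : intg mu f -> intg mu (fun x => c * f x).
Proof. by move=> fi; exact: (integrableZl measurableT c fi). Qed.

Lemma intg_norm f : intg mu f -> intg mu (fun x => `|f x|).
Proof. exact: integrable_norm. Qed.

Lemma intg_cst (c : R) : intg mu (fun=> c).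
Proof. by apply: finite_measure_integrable_cst. Qed.

Lemma intg_sum (I : Type) (s : seq I) (f : I -> T -> R) :
  (forall i, intg mu (f i)) -> intg mu (fun x => \sum_(i <- s) f i x).
Proof.
move=> fi; elim: s => [|i s ih].
  by apply: eq_integrable (intg_cst 0) => // x _ /=; rewrite big_nil.
apply: eq_integrable (intgD (fi i) ih) => // x _ /=; by rewrite big_cons.
Qed.

Lemma ae_intg_le f g : measurable_fun setT f -> intg mu g ->
  {ae mu, forall x, `|f x| <= `|g x|} -> intg mu f.
Proof.
move=> mf gi fg; apply/integrableP; split; first exact/measurable_EFinP.
have /integrableP[mg] := gi; apply: le_lt_trans.
apply: ae_ge0_le_integral => //; try exact: measurableT_comp.
  by apply: measurableT_comp => //; exact/measurable_EFinP.
by apply: filterS fg => x h _; rewrite lee_fin.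
Qed.

Lemma intg_le f g : measurable_fun setT f -> intg mu g ->
  (forall x, `|f x| <= g x) -> intg mu f.
Proof.
move=> mf gi fg; apply: (ae_intg_le mf gi); apply: aeW => x.
by rewrite (le_trans (fg x))// ler_norm.
Qed.

Lemma intg_bounded f (c : R) : measurable_fun setT f ->
  (forall x, `|f x| <= c) -> intg mu f.
Proof. by move=> mf; exact: intg_le (intg_cst c). Qed.

Lemma Rintegral_fin f : intg mu f ->
  (\int[mu]_x (f x)%:E)%E = (\int[mu]_x f x)%:E.
Proof. by move=> fi; rewrite fineK//; exact: integrable_fin_num. Qed.

Lemma ae_Rintegral_le f g : intg mu f -> intg mu g ->
  {ae mu, forall x, f x <= g x} -> \int[mu]_x f x <= \int[mu]_x g x.
Proof.
move=> fi gi fg; rewrite -subr_ge0 -RintegralB//.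
have mh : measurable_fun setT (fun x => `|g x - f x|).
  exact: intg_measurable (intg_norm (intgB gi fi)).
rewrite (_ : \int[mu]_x (g x - f x) = \int[mu]_x `|g x - f x|); last first.
  congr fine; apply: ae_eq_integral => //.
  - exact: measurable_int (intgB gi fi).
  - exact/measurable_EFinP.
  - by apply: filterS fg => x h _; rewrite ger0_norm// subr_ge0.
by apply: Rintegral_ge0.
Qed.

Lemma ae_Rintegral_eq f g : measurable_fun setT f -> measurable_fun setT g ->
  {ae mu, forall x, f x = g x} -> \int[mu]_x f x = \int[mu]_x g x.
Proof.
move=> mf mg fg; congr fine; apply: ae_eq_integral => //.
- exact/measurable_EFinP.
- exact/measurable_EFinP.
- by apply: filterS fg => x -> _.
Qed.

Lemma Rintegral_cst1 (c : R) : \int[mu]_x c = c.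
Proof. by rewrite Rintegral_cst// [X in fine X](@probability_setT _ _ _ mu) mulr1. Qed.

Lemma Rintegral_sum (I : Type) (s : seq I) (f : I -> T -> R) :
  (forall i, intg mu (f i)) ->
  \int[mu]_x (\sum_(i <- s) f i x) = \sum_(i <- s) \int[mu]_x f i x.
Proof.
move=> fi; elim: s => [|i s ih].
  rewrite big_nil -[RHS](Rintegral_cst1 0); apply: eq_Rintegral => x _.
  by rewrite big_nil.
rewrite big_cons -ih -RintegralD//; last exact: intg_sum.
by apply: eq_Rintegral => x _; rewrite big_cons.
Qed.

Lemma ge0_Rintegral_eq0 f : intg mu f -> (forall x, 0 <= f x) ->
  \int[mu]_x f x = 0 -> {ae mu, forall x, f x = 0}.
Proof.
move=> fi f0 f00.
have /(ae_eq_integral_abs mu measurableT (measurable_int _ fi)) :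
    (\int[mu]_x `|(EFin \o f) x|)%E = 0%E.
  under eq_integral do rewrite /= ger0_norm//.
  by rewrite Rintegral_fin// f00.
by apply: filterS => x /(_ I)[].
Qed.

Definition sqintg f := measurable_fun setT f /\ intg mu (fun x => f x ^+ 2).

Lemma sqintgM f g : sqintg f -> sqintg g -> intg mu (fun x => f x * g x).
Proof.
move=> [mf fi] [mg gi]; apply: (intg_le _ (intgD fi gi)).
  exact: measurable_funM.
move=> x; rewrite ler_norml; have := sqr_ge0 (f x - g x); have := sqr_ge0 (f x + g x); nra.
Qed.

Lemma sqintg_cst (c : R) : sqintg (fun=> c).
Proof. by split => //; exact: intg_cst. Qed.

Lemma sqintgD f g : sqintg f -> sqintg g -> sqintg (fun x => f x + g x).
Proof.
move=> [mf fi] [mg gi]; split; first exact: measurable_funD.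
apply: (intg_le _ (intgZ 2 (intgD fi gi))).
  by apply: measurable_funX; exact: measurable_funD.
move=> x; rewrite ger0_norm ?sqr_ge0//; have := sqr_ge0 (f x - g x); nra.
Qed.

Lemma sqintgZ (c : R) f : sqintg f -> sqintg (fun x => c * f x).
Proof.
move=> [mf fi]; split; first exact: measurable_funM.
apply: eq_integrable (intgZ (c ^+ 2) fi) => // x _ /=.
by rewrite exprMn.
Qed.

Lemma sqintgB f g : sqintg f -> sqintg g -> sqintg (fun x => f x - g x).
Proof.
move=> hf /(sqintgZ (-1)) hg; have := sqintgD hf hg.
by under eq_fun do rewrite mulN1r.
Qed.

Lemma sqintg_bounded f (c : R) : measurable_fun setT f ->
  (forall x, `|f x| <= c) -> sqintg f.
Proof.
move=> mf fc; split => //; apply: (@intg_bounded _ (c ^+ 2)).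
  exact: measurable_funX.
by move=> x; rewrite normrX lerXn2r ?nnegrE// (le_trans _ (fc x)).
Qed.

Lemma sqintg_intg f : sqintg f -> intg mu f.
Proof.
move=> hf; have := sqintgM hf (sqintg_cst 1).
by under eq_fun do rewrite mulr1.
Qed.

Lemma sqr_Rintegral_le f : sqintg f ->
  (\int[mu]_x f x) ^+ 2 <= \int[mu]_x (f x ^+ 2).
Proof.
move=> hf; have fi := sqintg_intg hf; set m := \int[mu]_x f x.
have : 0 <= \int[mu]_x ((f x - m) ^+ 2) by apply: Rintegral_ge0 => x _; exact: sqr_ge0.
have -> : \int[mu]_x ((f x - m) ^+ 2) =
    \int[mu]_x (f x ^+ 2 - (2 * m * f x - m ^+ 2)).
  by apply: eq_Rintegral => x _; ring.
have [_ f2i] := hf.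
rewrite RintegralB//; last exact: intgB (intgZ _ fi) (intg_cst _).
rewrite RintegralB//; [|exact: intgZ|exact: intg_cst].
rewrite RintegralZl// Rintegral_cst1 -/m; lra.
Qed.

(** Dominated convergence under [u ^+ 2]: at each point the indicator vanishes for large [n]. This
    supplies the truncation level in [K_weak_cvg]. *)
Lemma sqintg_tail u (e : R) : sqintg u -> 0 < e ->
  exists2 n : nat, intg mu (fun x => u x ^+ 2 * (n%:R < `|u x|)%R%:R) &
    \int[mu]_x (u x ^+ 2 * (n%:R < `|u x|)%R%:R) <= e.
Proof.
move=> [mu_ u2] e0.
pose t (n : nat) x := u x ^+ 2 * (n%:R < `|u x|)%R%:R.
have mt n : measurable_fun setT (t n).
  apply: measurable_funM; first exact: measurable_funX.
  rewrite (_ : (fun x => _) = fun x => if n%:R < `|u x| then 1 else 0); last first.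
    by apply/funext => x; case: (_ < _).
  apply: measurable_fun_ifT => //; apply: measurable_fun_ltr => //.
  exact: measurableT_comp.
have tu n x : `|t n x| <= u x ^+ 2.
  rewrite /t normrM ger0_norm ?sqr_ge0// ler_piMr ?sqr_ge0//.
  by case: (_ < _); rewrite ?normr1 ?normr0.
have [] := @dominated_convergence _ _ _ mu setT measurableT
  (fun n x => (t n x)%:E) (fun=> 0%E) (fun x => (u x ^+ 2)%:E) _ _ _ u2 _.
- by move=> n; exact/measurable_EFinP.
- exact: measurable_cst.
- apply: aeW => x _; apply: cvg_near_cst.
  have : \forall n \near \oo, `|u x| <= n%:R := nbhs_infty_ger _.
  by apply: filterS => n h; rewrite /t ltNge h mulr0.
- by apply: aeW => x n _; rewrite lee_fin.
move=> _ _; rewrite integral0 => /fine_cvgP[_ /cvgrPdist_le/(_ e e0)[n _ /(_ n (leqnn n))]].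
rewrite sub0r normrN => hn; exists n; last exact: le_trans (ler_norm _) hn.
exact: intg_le (mt n) u2 (tu n).
Qed.

(** Both sides expand to the same polynomial in the integrals of [f], [g] and [f * g]. With [a] and
    [b] the current values of two functionals, the left side has the shape of the bracket in
    [B1]. *)
Lemma Rintegral_covE f g (a b : R) : sqintg f -> sqintg g ->
  (a - \int[mu]_x f x) * (b - \int[mu]_x g x) +
    \int[mu]_x ((f x - \int[mu]_x f x) * (g x - \int[mu]_x g x)) =
  \int[mu]_x ((f x - a) * (g x - b)).
Proof.
move=> fs gs; have fi := sqintg_intg fs; have gi := sqintg_intg gs.
have fgi := sqintgM fs gs.
have E p q : \int[mu]_x ((f x - p) * (g x - q)) =
    \int[mu]_x (f x * g x) - q * (\int[mu]_x f x) - p * (\int[mu]_x g x) + p * q.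
  transitivity (\int[mu]_x (f x * g x - (q * f x + (p * g x - p * q)))).
    by apply: eq_Rintegral => x _; ring.
  have gpi : intg mu (fun x => p * g x - p * q) by apply: intgB; [exact: intgZ|exact: intg_cst].
  rewrite RintegralB//; last by apply: intgD => //; exact: intgZ.
  rewrite RintegralD//; last exact: intgZ.
  rewrite RintegralB//; [|exact: intgZ|exact: intg_cst].
  by rewrite (Rintegral_cst1 (p * q)) !RintegralZl//; ring.
by rewrite !E; ring.
Qed.

End integrable_real.

(** Tonelli applies to the positive and negative parts separately; where a section has no finite
    integral, [fine] supplies a default value without harming measurability. *)
Lemma measurable_Rintegral_fst d1 d2 (T1 : measurableType d1)
    (T2 : measurableType d2) (R : realType) (mu : probability T2 R)
    (k : T1 * T2 -> R) : measurable_fun setT k ->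
  measurable_fun setT (fun x => \int[mu]_y k (x, y)).
Proof.
move=> /measurable_EFinP mk; apply: (@measurableT_comp _ _ _ _ _ _ fine) => //.
rewrite (_ : (fun x => _) = fun x =>
  (\int[mu]_y (EFin \o k)^\+ (x, y) - \int[mu]_y (EFin \o k)^\- (x, y))%E); last first.
  apply/funext => x; rewrite [LHS]integralE.
  by congr (_ - _)%E; apply: eq_integral => y _; rewrite ?funeposE ?funenegE.
apply: emeasurable_funB.
- apply: (measurable_fun_fubini_tonelli_F (EFin \o k)^\+%E) => //.
  exact: measurable_funepos.
- apply: (measurable_fun_fubini_tonelli_F (EFin \o k)^\-%E) => //.
  exact: measurable_funeneg.
Qed.

(** * Product laws on sequence spaces *)

Section sequence_space.
Context d' (S : measurableType d').
Implicit Types D E : pred nat.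

(** These are the generators used by [measurable_functional], so that predicate is by conversion
    measurability on this type. *)
Definition path_space :=
  g_sigma_algebraType (generators setT (fun k (x : nat -> S) => x k)).

HB.instance Definition _ := Measurable.on path_space.

Implicit Types x y z : path_space.

Lemma measurable_path d (T : measurableType d) (g : T -> path_space) :
  (forall k, measurable_fun setT (fun t => g t k)) -> measurable_fun setT g.
Proof.
move=> mg; have := @measurability _ _ T path_space setT g
  (generators setT (fun k (x : nat -> S) => x k)) erefl; apply.
move=> _ [_ [k _ [A mA <-]] <-].
by have := mg k measurableT A mA; rewrite !setTI.
Qed.

Lemma measurable_coord k : measurable_fun setT (fun x : path_space => x k).
Proof.
by move=> _ A mA; apply: sub_sigma_algebra; exists k => //; exists A.
Qed.

Definition merge D x y : path_space := fun k => if D k then x k else y k.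

Definition mergep D (p : path_space * path_space) := merge D p.1 p.2.

Lemma measurable_mergep D : measurable_fun setT (mergep D).
Proof.
apply: measurable_path => k; rewrite /mergep /merge; case: (D k).
- exact: (measurableT_comp (measurable_coord k) measurable_fst).
- exact: (measurableT_comp (measurable_coord k) measurable_snd).
Qed.

HB.instance Definition _ D :=
  isMeasurableFun.Build _ _ _ _ (mergep D) (measurable_mergep D).

Lemma measurable_merge2 D x : measurable_fun setT (merge D x).
Proof.
apply: measurable_path => k; rewrite /merge; case: (D k); first exact: measurable_cst.
exact: measurable_coord.
Qed.

Lemma merge_merge D E x y z :
  merge E (merge D x y) z = merge (fun k => D k && E k) x (merge E y z).
Proof.
by apply/funext => k; rewrite /merge /=; case: (D k); case: (E k).
Qed.

Definition cylinder n (A : nat -> set S) : set path_space :=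
  [set x | forall j, (j < n)%N -> A j (x j)].

(** A pi-system generating the product sigma-algebra; the uniqueness of measures and the Dynkin
    argument below both run on it. *)
Definition cylinders : set (set path_space) :=
  [set C | exists n A, (forall j, measurable (A j)) /\ C = cylinder n A].

Lemma measurable_cylinder n A : (forall j, measurable (A j)) ->
  measurable (cylinder n A).
Proof.
move=> mA; rewrite (_ : cylinder n A =
    \bigcap_(j in `I_n) ((fun x : path_space => x j) @^-1` A j)) //.
apply: bigcap_measurableType => j _.
by rewrite -[X in measurable X]setTI; exact: measurable_coord.
Qed.

Lemma setI_closed_cylinders : setI_closed cylinders.
Proof.
move=> _ _ [n [A [mA ->]]] [m [B [mB ->]]].
pose A' j := if (j < n)%N then A j else setT.
pose B' j := if (j < m)%N then B j else setT.
exists (maxn n m), (fun j => A' j `&` B' j); split.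
  by move=> j; apply: measurableI; rewrite /A' /B'; case: ifP.
apply/seteqP; split=> [x [hA hB] j jnm|x h].
  by rewrite /A' /B'; split; case: ifP => // jn; [exact: hA|exact: hB].
split=> j jn; have [] := h j; rewrite ?leq_max ?jn ?orbT// /A' /B' jn//.
Qed.

Lemma measurable_cylinders : @measurable _ path_space = <<s cylinders >>.
Proof.
apply/seteqP; split; apply: smallest_sub.
- exact: smallest_sigma_algebra.
- move=> _ [k _ [A mA <-]]; apply: sub_sigma_algebra.
  exists k.+1, (fun j => if j == k then A else setT); split.
    by move=> j; case: ifP.
  rewrite setTI; apply/seteqP; split => [x Ax j _|x /(_ k)]; last by rewrite eqxx; apply.
  by case: eqP => [->|].
- exact: sigma_algebra_measurable.
- by move=> _ [n [A [mA ->]]]; exact: measurable_cylinder.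
Qed.

End sequence_space.

Section product_law.
Context d' (S : measurableType d') (R : realType).
Local Notation V := (path_space S).
Variable mu : probability V R.
Hypothesis muE : forall n (A : nat -> set S), (forall j, measurable (A j)) ->
  mu (cylinder n A) = (\prod_(j < n) mu [set x : V | A j (x j)])%E.
Implicit Types (D E : pred nat) (x y z : V) (h u v : V -> R).

(* Resampling the coordinates outside [D] preserves the law: check it on
   cylinders, where both sides factorize. *)
Lemma merge_law D A : measurable A ->
  (mu \x mu)%E (mergep D @^-1` A) = mu A.
Proof.
move=> mA.
rewrite -[LHS]/(pushforward (mu \x mu)%E (mergep D) A).
apply: (@g_sigma_algebra_measure_unique _ _ _ (@cylinders _ S) _ (fun=> setT)).
- by move=> _ [n [B [mB ->]]]; exact: measurable_cylinder.
- move=> _; exists 0%N, (fun=> setT); split => //.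
  by apply/seteqP; split.
- by apply/seteqP; split => // x _; exists 0%N.
- exact: setI_closed_cylinders.
- move=> _ [n [B [mB ->]]].
  (* [B1] holds the constraints on the coordinates kept from the first path, [B2] those on the
     coordinates taken from the second, so the preimage of a cylinder is a rectangle. *)
  pose B1 j := if D j then B j else setT; pose B2 j := if D j then setT else B j.
  have mB1 j : measurable (B1 j) by rewrite /B1; case: ifP.
  have mB2 j : measurable (B2 j) by rewrite /B2; case: ifP.
  rewrite -[LHS]/((mu \x mu)%E (mergep D @^-1` cylinder n B)).
  rewrite (_ : _ @^-1` _ = cylinder n B1 `*` cylinder n B2); last first.
    rewrite /B1 /B2; apply/seteqP; split => [[x y] /= h|[x y] /= [h1 h2] j jn].
      by split => j jn; have := h j jn; rewrite /mergep /merge /=; case: (D j).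
    by have := h1 j jn; have := h2 j jn; rewrite /mergep /merge /=; case: (D j).
  apply: (@etrans _ _ (mu (cylinder n B1) * mu (cylinder n B2))%E).
    by apply: product_measure1E; exact: measurable_cylinder.
  apply: etrans (esym (muE n mB)).
  rewrite !muE// -big_split/=; apply: eq_bigr => j _; rewrite /B1 /B2.
  have muT : mu [set x : V | [set: S] (x j)] = 1%E by exact: probability_setT.
  case: (D j).
    by rewrite -[RHS]mule1; congr (_ * _)%E; exact: muT.
  by rewrite -[RHS]mul1e; congr (_ * _)%E; exact: muT.
- move=> k; apply: (@le_lt_trans _ _ (mu setT * mu setT)%E).
    by rewrite -product_measure1E// setXTT.
  by rewrite probability_setT mule1 ltry.
- by rewrite -measurable_cylinders.
Qed.

Lemma ge0_integral_mergep D (k : V -> \bar R) : measurable_fun setT k ->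
  (forall x, (0 <= k x)%E) ->
  (\int[(mu \x mu)%E]_p k (mergep D p) = \int[mu]_x k x)%E.
Proof.
move=> mk k0; rewrite -[LHS](ge0_integral_pushforward (@measurable_mergep _ S D) _ measurableT mk)//.
by apply: eq_measure_integral => A mA _; exact: merge_law.
Qed.

Lemma measurable_merge_comp D h : measurable_fun setT h ->
  measurable_fun setT (fun p : V * V => h (mergep D p)).
Proof. by move=> mh; exact: (measurableT_comp mh (@measurable_mergep _ S D)). Qed.

Lemma integrable_mergep D h : intg mu h ->
  (mu \x mu)%E.-integrable setT (fun p => (h (mergep D p))%:E).
Proof.
move=> /integrableP[mh hoo]; apply/integrableP; split.
  exact: (measurableT_comp mh (@measurable_mergep _ S D)).
apply: le_lt_trans hoo.
by rewrite (ge0_integral_mergep D (k := fun x => `|(h x)%:E|%E))//; exact: measurableT_comp.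
Qed.

(* [K D h] at a sample path is a version of [E[h(X) | X_k, k in D]]. *)
Definition K D h x := \int[mu]_y h (merge D x y).

Lemma measurable_K D h : measurable_fun setT h -> measurable_fun setT (K D h).
Proof.
move=> mh; exact: (measurable_Rintegral_fst mu (measurable_merge_comp D mh)).
Qed.

(** Fubini grants integrable sections only almost everywhere, which is why linearity, the tower
    property and Jensen's inequality for [K] are almost-everywhere statements. *)
Lemma intg_section D h : intg mu h ->
  {ae mu, forall x, intg mu (fun y => h (merge D x y))}.
Proof. by move=> /(integrable_mergep D)/ae_integrable1. Qed.

Lemma K_fubini D h : intg mu h -> {ae mu, forall x, (K D h x)%:E =
  (\int[mu]_y (h (merge D x y))%:E)%E}.
Proof.
by move=> hi; apply: filterS (intg_section D hi) => x ?; rewrite Rintegral_fin.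
Qed.

Lemma intg_K D h : intg mu h -> intg mu (K D h).
Proof.
move=> hi; have /integrableP[mH Hoo] := integrable_fubini_F (integrable_mergep D hi).
have mK : measurable_fun setT (EFin \o K D h).
  by apply/measurable_EFinP; exact: measurable_K (intg_measurable hi).
apply/integrableP; split => //; apply: le_lt_trans Hoo.
rewrite le_eqVlt; apply/orP; left; apply/eqP; apply: ae_eq_integral => //.
- exact: measurableT_comp.
- exact: measurableT_comp.
- apply: filterS (K_fubini D hi) => x /= e _.
  by rewrite -[LHS]/(`|(K D h x)%:E|%E) e.
Qed.

Lemma Rintegral_K D h : intg mu h -> \int[mu]_x K D h x = \int[mu]_x h x.
Proof.
move=> hi; have hi' := integrable_mergep D hi; congr fine.
transitivity (\int[mu]_x fubini_F mu (fun p => (h (mergep D p))%:E) x)%E.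
  apply: ae_eq_integral => //.
  - by apply/measurable_EFinP; exact: measurable_K (intg_measurable hi).
  - exact: measurable_fubini_F hi'.
  - by apply: filterS (K_fubini D hi) => x ->.
rewrite (integral12_prod_meas1 hi').
rewrite -[LHS](integral_pushforward (@measurable_mergep _ S D) (measurable_int _ hi) hi' measurableT)//.
by apply: eq_measure_integral => A mA _; exact: merge_law.
Qed.

(** The functional counterpart of measurability with respect to [sigma(X_k, k in D)]. *)
Definition depends_on D u := forall x y, u (merge D x y) = u x.

Lemma depends_on_K D h : depends_on D (K D h).
Proof.
move=> x y; apply: eq_Rintegral => z _; congr h; apply/funext => k.
by rewrite /merge; case: (D k).
Qed.

Lemma depends_on_le D E u : (forall k, D k -> E k) -> depends_on D u ->
  depends_on E u.
Proof.
move=> DE Du x y; rewrite -(Du (merge E x y) x) -[in RHS](Du x x); congr u.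
by apply/funext => k; rewrite /merge; case: (boolP (D k)) => // /DE ->.
Qed.

Lemma K_depends_on D u : depends_on D u -> K D u = u.
Proof.
move=> Du; apply/funext => x; rewrite -[RHS](Rintegral_cst1 mu).
by apply: eq_Rintegral => y _; rewrite Du.
Qed.

Lemma K_mul D u h : depends_on D u -> intg mu h ->
  {ae mu, forall x, K D (fun y => u y * h y) x = u x * K D h x}.
Proof.
move=> Du hi; apply: filterS (intg_section D hi) => x hx.
by rewrite -RintegralZl//; apply: eq_Rintegral => y _; rewrite Du.
Qed.

Lemma Rintegral_mulK D u h : depends_on D u -> measurable_fun setT u ->
  intg mu h -> intg mu (fun x => u x * h x) ->
  \int[mu]_x (u x * K D h x) = \int[mu]_x (u x * h x).
Proof.
move=> Du mu_ hi uhi; rewrite -(Rintegral_K D uhi).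
apply: ae_Rintegral_eq.
- by apply: measurable_funM => //; exact: measurable_K (intg_measurable hi).
- exact: intg_measurable (intg_K D uhi).
- by apply: filterS (K_mul Du hi) => x ->.
Qed.

(** Tower property for arbitrary index sets, which independence makes possible: by [merge_merge] the
    resampled part is a merge of two independent paths, and such a merge again has law [mu]. *)
Lemma K_K D E h : intg mu h ->
  {ae mu, forall x, K D (K E h) x = K (fun k => D k && E k) h x}.
Proof.
move=> hi; apply: filterS (intg_section (fun k => D k && E k) hi) => x hx.
rewrite /K -[RHS](Rintegral_K E hx); apply: eq_Rintegral => y _.
by apply: eq_Rintegral => z _; rewrite merge_merge.
Qed.

Lemma KB D g h : intg mu g -> intg mu h ->
  {ae mu, forall x, K D (fun y => g y - h y) x = K D g x - K D h x}.
Proof.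
move=> gi hi; apply: filterS2 (intg_section D gi) (intg_section D hi) => x gx hx.
by rewrite /K RintegralB.
Qed.

Lemma normr_K_le D h : intg mu h ->
  {ae mu, forall x, `|K D h x| <= K D (fun y => `|h y|) x}.
Proof.
by move=> hi; apply: filterS (intg_section D hi) => x hx; exact: le_normr_Rintegral.
Qed.

Lemma Rintegral_norm_K_le D h : intg mu h ->
  \int[mu]_x `|K D h x| <= \int[mu]_x `|h x|.
Proof.
move=> hi; rewrite -(Rintegral_K D (intg_norm hi)).
apply: ae_Rintegral_le (normr_K_le D hi).
- exact: intg_norm (intg_K D hi).
- exact: intg_K (intg_norm hi).
Qed.

Lemma sqintg_section D h : sqintg mu h ->
  {ae mu, forall x, sqintg mu (fun y => h (merge D x y))}.
Proof.
move=> [mh h2]; apply: filterS (intg_section D h2) => x hx; split => //.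
exact: (measurableT_comp mh (@measurable_merge2 _ S D x)).
Qed.

Lemma sqr_K_le D h : sqintg mu h ->
  {ae mu, forall x, K D h x ^+ 2 <= K D (fun y => h y ^+ 2) x}.
Proof.
by move=> hs; apply: filterS (sqintg_section D hs) => x hx; exact: sqr_Rintegral_le.
Qed.

Lemma sqintg_K D h : sqintg mu h -> sqintg mu (K D h).
Proof.
move=> hs; have [mh h2] := hs; have mK := measurable_K D mh; split => //.
apply: (ae_intg_le _ (intg_K D h2)); first exact: measurable_funX.
apply: filterS (sqr_K_le D hs) => x hx.
by rewrite ger0_norm ?sqr_ge0// (le_trans hx)// ler_norm.
Qed.

Lemma Rintegral_sqr_K_le D h : sqintg mu h ->
  \int[mu]_x (K D h x ^+ 2) <= \int[mu]_x (h x ^+ 2).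
Proof.
move=> hs; have [_ h2] := hs; have [_ K2] := sqintg_K D hs.
rewrite -(Rintegral_K D h2); apply: ae_Rintegral_le (sqr_K_le D hs) => //.
exact: intg_K.
Qed.

Lemma K_lin D (c : R) g h : intg mu g -> intg mu h ->
  {ae mu, forall x, K D (fun y => c * g y + h y) x = c * K D g x + K D h x}.
Proof.
move=> gi hi; apply: filterS2 (intg_section D gi) (intg_section D hi) => x gx hx.
by rewrite /K RintegralD//; [rewrite RintegralZl|exact: intgZ].
Qed.

(** * Levy's upward theorem in L1 and its weak form for L2 *)

Definition first n : pred nat := fun k => (k < n)%N.

(* The functionals satisfying Levy's upward theorem in L1; those depending on
   finitely many coordinates do, and the class is closed in L1. *)
Definition K_cvg h := intg mu h /\ forall e : R, 0 < e ->
  exists n0, forall n, (n0 <= n)%N -> \int[mu]_x `|K (first n) h x - h x| <= e.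

Let intg_KB n h : intg mu h -> intg mu (fun x => `|K (first n) h x - h x|).
Proof. by move=> hi; exact: intg_norm (intgB (intg_K _ hi) hi). Qed.

Lemma K_cvg_depends_on n h : depends_on (first n) h -> intg mu h -> K_cvg h.
Proof.
move=> hn hi; split => // e e0; exists n => m nm.
rewrite K_depends_on; last first.
  by apply: depends_on_le hn => k /leq_trans; exact.
under eq_Rintegral do rewrite subrr normr0.
by rewrite Rintegral_cst1 ltW.
Qed.

Lemma K_cvg_lin (c : R) g h : K_cvg g -> K_cvg h ->
  K_cvg (fun x => c * g x + h x).
Proof.
move=> [gi gc] [hi hc]; have chi := intgD (intgZ c gi) hi; split => // e e0.
have c0 : 0 < `|c| + 1 by rewrite ltr_wpDl.
have e2 : 0 < e / 2 by rewrite divr_gt0.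
have e3 : 0 < e / 2 / (`|c| + 1) by rewrite divr_gt0.
have [n1 h1] := gc _ e3; have [n2 h2] := hc _ e2.
exists (maxn n1 n2) => n; rewrite geq_max => /andP[/h1 {}h1 /h2 {}h2].
apply: (@le_trans _ _ (\int[mu]_x (`|c| * `|K (first n) g x - g x| + `|K (first n) h x - h x|))).
  apply: ae_Rintegral_le.
  - exact: intg_KB.
  - by apply: intgD; [apply: intgZ|]; exact: intg_KB.
  - apply: filterS (K_lin (first n) c gi hi) => x ->.
    rewrite -normrM (le_trans _ (ler_normD _ _))//.
    by rewrite le_eqVlt; apply/orP; left; apply/eqP; congr `| _ |; ring.
rewrite RintegralD//; [|by apply: intgZ; exact: intg_KB|exact: intg_KB].
rewrite RintegralZl//; last exact: intg_KB.
rewrite [leRHS](splitr e) lerD//.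
rewrite (le_trans (ler_wpM2l _ h1))// mulrA ler_pdivrMr// mulrC.
by rewrite ler_wpM2l ?(ltW e2)// lerDl.
Qed.

(** [K] contracts the L1 norm, so replacing [h] by a nearby [g] costs at most [e / 3] inside [K] and
    [e / 3] outside. *)
Lemma K_cvg_approx h : intg mu h ->
  (forall e : R, 0 < e -> exists2 g, K_cvg g & \int[mu]_x `|h x - g x| <= e) ->
  K_cvg h.
Proof.
move=> hi happ; split => // e e0.
have e3 : 0 < e / 3 by rewrite divr_gt0.
have [g [gi gc] hg] := happ _ e3; have [n0 hn0] := gc _ e3.
exists n0 => n /hn0 {}hn0; have di := intgB hi gi.
have nKd := intg_norm (intg_K (first n) di).
apply: (@le_trans _ _ (\int[mu]_x (`|K (first n) (fun y => h y - g y) x| +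
    (`|K (first n) g x - g x| + `|h x - g x|)))).
  apply: ae_Rintegral_le.
  - exact: intg_KB.
  - apply: intgD => //; apply: intgD; [exact: intg_KB|exact: intg_norm].
  - apply: filterS (KB (first n) hi gi) => x ->.
    rewrite [in leRHS](distrC (h x)).
    rewrite (_ : _ - h x = (K (first n) h x - K (first n) g x) +
       ((K (first n) g x - g x) + (g x - h x))); last by ring.
    by rewrite (le_trans (ler_normD _ _))// lerD2l ler_normD.
rewrite !RintegralD//; [|exact: intg_KB|exact: intg_norm|]; last first.
  by apply: intgD; [exact: intg_KB|exact: intg_norm].
have := Rintegral_norm_K_le (first n) di; lra.
Qed.

(** Dynkin induction from cylinders, which depend on finitely many coordinates. Complements follow
    by linearity; a disjoint union is the L1 limit of its finite subunions by sigma-additivity. *)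
Lemma K_cvg_indic A : measurable A -> K_cvg (\1_A).
Proof.
have iA B : measurable B -> intg mu (\1_B : V -> R).
  by move=> mB; exact: integrable_indic.
move=> mA.
apply: (@dynkin_induction _ V (@cylinders _ S) (fun B => K_cvg \1_B)).
- exact: measurable_cylinders.
- exact: setI_closed_cylinders.
- apply: (@K_cvg_depends_on 0); last exact: iA.
  by move=> x y; rewrite !indicT.
- move=> _ [n [B [mB ->]]]; apply: (@K_cvg_depends_on n).
    move=> x y; rewrite !indicE; congr (_%:R : R); congr nat_of_bool.
    apply/idP/idP; rewrite !inE => h j jn; have := h j jn;
      by rewrite /merge /first jn.
  by apply: iA; exact: measurable_cylinder.
- move=> B mB hB.
  have h1 : K_cvg (fun=> 1 : R).
    by apply: (@K_cvg_depends_on 0) => //; exact: intg_cst.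
  have := K_cvg_lin (-1) hB h1; congr K_cvg; apply/funext => x.
  by rewrite !indicE in_setC; case: (x \in B) => /=; ring.
- move=> F mF tF hF; have mU : measurable (\bigcup_k F k) by exact: bigcupT_measurable.
  apply: K_cvg_approx; first exact: iA.
  move=> e e0.
  pose g n x : R := \sum_(i < n) \1_(F i) x.
  have gc n : K_cvg (g n).
    elim: n => [|n ih].
      apply: (@K_cvg_depends_on 0); first by move=> x y; rewrite /g !big_ord0.
      rewrite (_ : g 0%N = fun=> 0) ?big_ord0; first exact: intg_cst.
      by apply/funext => x; rewrite /g big_ord0.
    have := K_cvg_lin 1 (hF n) ih; congr K_cvg; apply/funext => x.
    by rewrite /g big_ord_recr/= mul1r addrC.
  have gi n : intg mu (g n) by have [] := gc n.
  have IE B : measurable B -> \int[mu]_x (\1_B x : R) = fine (mu B).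
    by move=> mB; rewrite /Rintegral integral_indic// setIT.
  have gE n : \int[mu]_x g n x = fine (\sum_(0 <= i < n) mu (F i))%E.
    rewrite big_mkord /g Rintegral_sum => [|i]; last exact: iA.
    by rewrite -sum_fine => [|i _]; [apply: eq_bigr => i _; exact: IE|exact: fin_num_measure].
  have gU n x : g n x <= \1_(\bigcup_k F k) x.
    have [[j /= jn Fjx]|nF] := pselect (exists2 j : 'I_n, true & F j x); last first.
      rewrite /g big1 ?indicE// => i _; rewrite indicE memNset// => Fix.
      by apply: nF; exists i.
    rewrite /g (bigD1 j)//= big1 => [|i ij].
      by rewrite addr0 !indicE !mem_set//; exists j.
    rewrite indicE memNset// => Fix; move/eqP: ij; apply.
    by apply: val_inj; apply: (tF i j) => //; exists x.
  have : fine (\sum_(0 <= i < n) mu (F i))%E @[n --> \oo] --> fine (mu (\bigcup_k F k)).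
    apply: fine_cvg; rewrite fineK ?fin_num_measure//.
    exact: measure_semi_sigma_additive.
  move=> /cvgrPdist_le/(_ e e0)[n _ /(_ n (leqnn n)) hn].
  exists (g n) => //; apply: le_trans hn.
  rewrite -gE -(IE _ mU) -RintegralB//; last exact: iA.
  apply: le_trans (ler_norm _); apply: ae_Rintegral_le.
  - exact: intg_norm (intgB (iA _ mU) (gi n)).
  - exact: intgB (iA _ mU) (gi n).
  - by apply: aeW => x; rewrite ger0_norm// subr_ge0.
- by rewrite -measurable_cylinders.
Qed.

Import HBSimple.

Lemma K_cvg_intg h : intg mu h -> K_cvg h.
Proof.
move=> hi; apply: (K_cvg_approx hi) => e e0.
have [g [gi _ /fine_cvgP[_ /cvgrPdist_le/(_ e e0)[n _ /(_ n (leqnn n))]]]] :=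
  approximation_sfun_integrable measurableT hi.
rewrite sub0r normrN => hn; exists (g n); last first.
  apply: le_trans hn; apply: le_trans (ler_norm _).
  by rewrite le_eqVlt; apply/orP; left.
have cst0 : K_cvg (fun=> 0 : R).
  by apply: (@K_cvg_depends_on 0) => //; exact: intg_cst.
have [s gs] : exists s : seq R, forall x, g n x = \sum_(r <- s) r * \1_(g n @^-1` [set r]) x.
  exists (finmap.enum_fset (fset_set (range (g n)))) => x.
  by rewrite [LHS]fimfunE fsbig_finite.
rewrite (funext gs : (g n : V -> R) = _).
elim: s {gs} => [|r s ih].
  by under eq_fun do rewrite big_nil.
have := K_cvg_lin r (@K_cvg_indic (g n @^-1` [set r]) _) ih.
rewrite (_ : (fun x => _ + _) = (fun x => \sum_(j <- r :: s) j * \1_(g n @^-1` [set j]) x)).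
  by apply; exact: measurable_sfunP.
by apply/funext => x; rewrite big_cons.
Qed.

(* L1 convergence handles the bounded part of [u], Cauchy-Schwarz its tail. *)
Lemma K_weak_cvg u h : sqintg mu u -> sqintg mu h ->
  \int[mu]_x (u x * K (first n) h x) @[n --> \oo] --> \int[mu]_x (u x * h x).
Proof.
move=> us hs; apply/cvgrPdist_le => e e0.
have hi := sqintg_intg hs; have [mu_ u2] := us; have [_ h2] := hs.
pose H := \int[mu]_x (h x ^+ 2).
have H0 : 0 <= H by apply: Rintegral_ge0 => x _; exact: sqr_ge0.
(* On the tail, with [d = k - h], the bound is [|u| |d| <= u^2 / (2 eta) + eta d^2 / 2]. As
   [d^2 <= 2 (k^2 + h^2)] integrates to at most [4 H], the second part is at most [e / 3]; the tail
   threshold [2 * eta * (e / 3)] does the same for the first. *)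
pose eta := e / (6 * (H + 1)).
have eta0 : 0 < eta by rewrite divr_gt0// mulr_gt0// ltr_wpDl.
have d0 : 0 < 2 * eta * (e / 3).
  by rewrite pmulr_lgt0 ?divr_gt0// pmulr_lgt0.
have [M ti hM] := @sqintg_tail _ _ _ mu u (2 * eta * (e / 3)) us d0.
have [_ /(_ (e / (3 * (M%:R + 1))))[]] := K_cvg_intg hi.
  by rewrite divr_gt0// mulr_gt0// ltr_wpDl.
move=> n0 hn0; exists n0 => // n /hn0 {hn0}.
set k := K (first n) h => hn.
have ks : sqintg mu k by exact: sqintg_K.
have [_ k2] := ks; have dks := sqintgB ks hs; have [md d2] := dks.
have di := sqintg_intg dks; pose t x := u x ^+ 2 * (M%:R < `|u x|)%R%:R.
have ui := sqintgM us ks; have uhi := sqintgM us hs.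
rewrite distrC -RintegralB//.
have ni := intg_norm di.
apply: (@le_trans _ _ (\int[mu]_x (M%:R * `|k x - h x| +
   ((2 * eta)^-1 * t x + eta / 2 * (2 * (k x ^+ 2 + h x ^+ 2)))))).
  apply: le_trans (le_normr_Rintegral _ _) _ => //; first exact: intgB.
  apply: ae_Rintegral_le.
  - exact: intg_norm (intgB ui uhi).
  - by apply: intgD; [exact: intgZ|apply: intgD; [exact: intgZ|do 2 apply: intgZ; exact: intgD]].
  apply: aeW => x; rewrite -mulrBr normrM.
  have d4 : `|k x - h x| ^+ 2 <= 2 * (k x ^+ 2 + h x ^+ 2).
    by rewrite real_normK ?num_real//; have := sqr_ge0 (k x + h x); nra.
  rewrite /t; case: (ltP M%:R `|u x|) => hu; rewrite ?mulr1 ?mulr0 ?add0r.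
    have : `|u x| * `|k x - h x| <= (2 * eta)^-1 * u x ^+ 2 + eta / 2 * `|k x - h x| ^+ 2.
      rewrite -(real_normK (num_real (u x))).
      move: (`|u x|) (`|k x - h x|) => a b.
      rewrite -subr_ge0 (_ : _ - _ = (a - eta * b) ^+ 2 / (2 * eta)); last first.
        by field; rewrite gt_eqF.
      by rewrite divr_ge0 ?sqr_ge0// mulr_ge0// ltW.
    move=> /le_trans; apply; apply: ler_wpDl; first exact: mulr_ge0.
    by rewrite lerD2l ler_wpM2l// divr_ge0// ltW.
  rewrite (le_trans (ler_wpM2r _ hu))// lerDl.
  apply: mulr_ge0; first by rewrite divr_ge0// ltW.
  by rewrite mulr_ge0// addr_ge0 ?sqr_ge0.
rewrite RintegralD//; [|exact: intgZ|]; last first.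
  by apply: intgD; [exact: intgZ|do 2 apply: intgZ; exact: intgD].
rewrite RintegralD//; [|exact: intgZ|]; last by do 2 apply: intgZ; exact: intgD.
rewrite !RintegralZl//; [|exact: intgD|by apply: intgZ; exact: intgD].
rewrite RintegralD//.
have kH : \int[mu]_x (k x ^+ 2) <= H by exact: Rintegral_sqr_K_le.
rewrite (_ : e = e / 3 + (e / 3 + e / 3)); last by field.
apply: lerD; last apply: lerD.
- rewrite (le_trans (ler_wpM2l _ hn))// mulrC -mulrA ler_wpM2l ?(ltW e0)//.
  by rewrite invfM -mulrA ler_piMr// mulrC ler_pdivrMr ?ltr_wpDl// mul1r lerDl.
- apply: le_trans (ler_wpM2l _ hM) _; first by rewrite invr_ge0 mulr_ge0// ltW.
  by rewrite mulKf// mulf_neq0// gt_eqF.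
- apply: (@le_trans _ _ (eta / 2 * (2 * (2 * H)))).
    apply: ler_wpM2l; first by rewrite divr_ge0// ltW.
    by rewrite ler_pM2l// mulr2n mulrDl mul1r lerD2r.
  rewrite /eta; have H1 : 0 < H + 1 by rewrite ltr_wpDl.
  rewrite -subr_ge0 (_ : _ - _ = e / 3 / (H + 1)); last by field; rewrite gt_eqF.
  by apply: divr_ge0; [apply: divr_ge0; exact: ltW|exact: ltW].
Qed.

(* The martingale differences [E[h | F_i] - E[h | F_(i-1)]]. *)
Definition incr i h x := K (first i.+1) h x - K (first i) h x.

Definition except i : pred nat := fun k => k != i.

(** Indices start at 0, so [first i.+1] stands for [F_i] and [first i] for [F_(i-1)]. Through [K_K],
    these set identities say that [E_i] and [E[. | F_i]] compose to [E[. | F_(i-1)]]. *)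
Lemma andb_except_firstS i : (fun k => except i k && first i.+1 k) = first i.
Proof.
by apply/funext => k; rewrite /except /first ltnS ltn_neqAle.
Qed.

Lemma andb_except_first i : (fun k => except i k && first i k) = first i.
Proof.
apply/funext => k; rewrite /except /first.
by case: (ltnP k i) => ki; rewrite ?andbF// andbT; apply/eqP => e; rewrite e ltnn in ki.
Qed.

Lemma andb_firstS_except i : (fun k => first i.+1 k && except i k) = first i.
Proof. by rewrite -(andb_except_firstS i); apply/funext => k; rewrite andbC. Qed.

Lemma sum_incr n h x : \sum_(i < n) incr i h x = K (first n) h x - K (first 0) h x.
Proof.
rewrite -(big_mkord xpredT (fun i => incr i h x)).
exact: (telescope_sumr (fun i => K (first i) h x) (leq0n n)).
Qed.

Lemma K_first0 h x : K (first 0) h x = \int[mu]_y h y.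
Proof. by []. Qed.

Lemma sqintg_incr i h : sqintg mu h -> sqintg mu (incr i h).
Proof. by move=> hs; apply: sqintgB; exact: sqintg_K. Qed.

Lemma depends_on_incr i h : depends_on (first i.+1) (incr i h).
Proof.
move=> x y; rewrite /incr (depends_on_K (first i.+1)).
congr (_ - _); apply: (depends_on_le _ (@depends_on_K (first i) h)) => k.
exact: ltnW.
Qed.

Lemma K_except_incr i h : intg mu h -> {ae mu, forall x, K (except i) (incr i h) x = 0}.
Proof.
move=> hi; apply: filterS3 (KB (except i) (intg_K (first i.+1) hi) (intg_K (first i) hi))
  (K_K (except i) (first i.+1) hi) (K_K (except i) (first i) hi) => x -> -> ->.
by rewrite andb_except_firstS andb_except_first subrr.
Qed.

Lemma Rintegral_incrM_K i h u : sqintg mu h -> sqintg mu u ->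
  \int[mu]_x (incr i h x * K (except i) u x) = 0.
Proof.
move=> hs us; have cs := sqintg_incr i hs; have [mK _] := sqintg_K (except i) us.
transitivity (\int[mu]_x (K (except i) u x * incr i h x)).
  by apply: eq_Rintegral => x _; rewrite mulrC.
rewrite -(Rintegral_mulK (depends_on_K _ _) mK (sqintg_intg cs)); last first.
  exact: sqintgM (sqintg_K _ us) cs.
rewrite -[RHS](Rintegral_cst1 mu); apply: ae_Rintegral_eq => //.
  by apply: measurable_funM => //; apply: measurable_K; have [] := cs.
by apply: filterS (K_except_incr i (sqintg_intg hs)) => x ->; rewrite mulr0.
Qed.

(** [E_i] annihilates the increment, hence [K (except i) u] is orthogonal to it and may be
    subtracted: this is how [D_i] appears in the covariance formula. *)
Lemma Rintegral_incrM i h u : sqintg mu h -> sqintg mu u ->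
  \int[mu]_x (incr i h x * u x) =
  \int[mu]_x (incr i h x * (u x - K (except i) u x)).
Proof.
move=> hs us; have cs := sqintg_incr i hs.
under [RHS]eq_Rintegral do rewrite mulrBr.
rewrite RintegralB//; [|exact: sqintgM|exact: sqintgM cs (sqintg_K _ us)].
by rewrite Rintegral_incrM_K// subr0.
Qed.

(** Tested against functions of the first [i.+1] coordinates, [K (except i) h] acts as
    [K (first i) h] by the tower property. This identifies the increment with [E[D_i h | F_i]]. *)
Lemma Rintegral_mul_incr i h u : sqintg mu h -> sqintg mu u ->
  depends_on (first i.+1) u ->
  \int[mu]_x (u x * incr i h x) = \int[mu]_x (u x * (h x - K (except i) h x)).
Proof.
move=> hs us uD; have [mu_ _] := us; have hi := sqintg_intg hs.
have ks D := sqintg_K D hs.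
rewrite /incr; under eq_Rintegral do rewrite mulrBr.
under [RHS]eq_Rintegral do rewrite mulrBr.
have i1 := sqintgM us (ks (first i.+1)); have i2 := sqintgM us (ks (first i)).
have i3 := sqintgM us hs; have i4 := sqintgM us (ks (except i)).
rewrite (RintegralB measurableT i1 i2) (RintegralB measurableT i3 i4).
rewrite (Rintegral_mulK uD mu_ hi i3); congr (_ - _).
rewrite -(Rintegral_mulK uD mu_ (sqintg_intg (ks (except i))) i4).
have [mk _] := ks (first i); have [mk' _] := sqintg_K (first i.+1) (ks (except i)).
apply: ae_Rintegral_eq; [exact: measurable_funM..|].
apply: filterS (K_K (first i.+1) (except i) hi) => x ->.
by rewrite andb_firstS_except.
Qed.

(** The increments telescope to [K (first n) h] minus the mean of [h], which is 0, and [K_weak_cvg]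
    gives the limit. *)
Lemma sum_Rintegral_incr_cvg h u : sqintg mu h -> sqintg mu u ->
  \int[mu]_x h x = 0 ->
  \sum_(i < n) \int[mu]_x (incr i h x * u x) @[n --> \oo] -->
  \int[mu]_x (u x * h x).
Proof.
move=> hs us h0; rewrite (_ : (fun n => _) = fun n => \int[mu]_x (u x * K (first n) h x)).
  exact: K_weak_cvg.
apply/funext => n; rewrite -Rintegral_sum; last first.
  by move=> i; exact: sqintgM (sqintg_incr i hs) us.
apply: eq_Rintegral => x _.
by rewrite -mulr_suml sum_incr K_first0 h0 subr0 mulrC.
Qed.

(** Used with [D = except i] and [u] an indicator, it turns the bracket of [B1] into one integral
    over the resampled coordinate. *)
Lemma K_covE D h u x : sqintg mu (fun y => h (merge D x y)) ->
  sqintg mu (fun y => u (merge D x y)) ->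
  (h x - K D h x) * (u x - K D u x) +
    K D (fun z => (h z - K D h z) * (u z - K D u z)) x =
  \int[mu]_y ((h (merge D x y) - h x) * (u (merge D x y) - u x)).
Proof.
move=> hx ux; rewrite -(Rintegral_covE (h x) (u x) hx ux); congr (_ + _).
by apply: eq_Rintegral => y _; rewrite !depends_on_K.
Qed.

End product_law.

(** * Transfer between the probability space and a law *)

Section distribution_transfer.
Context d (T : measurableType d) d' (T' : measurableType d') (R : realType).
Variables (P : probability T R) (Y : {RV P >-> T'}).
Implicit Types h : T' -> R.

Lemma Rintegral_distribution h : measurable_fun setT h ->
  \int[distribution P Y]_y h y = \int[P]_w h (Y w).
Proof.
move=> mh; have mEh : measurable_fun setT (EFin \o h) by exact/measurable_EFinP.
congr fine; rewrite integralE [RHS]integralE; congr (_ - _)%E.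
  rewrite ge0_integral_distribution//; last exact: measurable_funepos.
  by apply: eq_integral => w _ /=; rewrite !funeposE.
rewrite ge0_integral_distribution//; last exact: measurable_funeneg.
by apply: eq_integral => w _ /=; rewrite !funenegE.
Qed.

Lemma intg_distribution h : measurable_fun setT h ->
  (distribution P Y).-integrable setT (EFin \o h) <-> intg P (fun w => h (Y w)).
Proof.
move=> mh; have mEh : measurable_fun setT (EFin \o h) by exact/measurable_EFinP.
have E : (\int[distribution P Y]_y `|(EFin \o h) y| = \int[P]_w `|(h (Y w))%:E|)%E.
  rewrite (@ge0_integral_distribution _ _ _ _ _ P Y (fun y => `|(EFin \o h) y|%E))//.
  exact: measurableT_comp.
split=> /integrableP[_ hoo]; apply/integrableP; split => //.
- by apply/measurable_EFinP; exact: measurableT_comp.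
- by rewrite -E.
- by rewrite E.
Qed.

Lemma ae_distribution (Q : T' -> Prop) :
  {ae distribution P Y, forall y, Q y} -> {ae P, forall w, Q (Y w)}.
Proof.
move=> [N [mN N0 sub]]; exists (Y @^-1` N); split => //.
  by rewrite -[X in measurable X]setTI; exact: measurable_funP.
by move=> w /= ?; exact: sub.
Qed.

End distribution_transfer.

(** * Difference operators of independent sequences *)

Section independent_sequence.
Context (R : realType) d (T : measurableType d) (P : probability T R)
  d' (S : measurableType d') (X : nat -> {RV P >-> S}).
Local Notation V := (path_space S).
Implicit Types (h u : V -> R) (x y : V).

Definition path_rv : T -> V := sample_path X.

Lemma measurable_path_rv : measurable_fun setT path_rv.
Proof. by apply: measurable_path => k; exact: measurable_funP. Qed.

HB.instance Definition _ := isMeasurableFun.Build _ _ _ _ path_rv measurable_path_rv.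

Definition path_law : probability V R := distribution P path_rv.

Lemma path_law_cylinder : mutually_independent X ->
  forall n (A : nat -> set S), (forall j, measurable (A j)) ->
  path_law (cylinder n A) = (\prod_(j < n) path_law [set x : V | A j (x j)])%E.
Proof.
move=> hX n A mA.
pose J : {fset nat} := [fset j in iota 0 n]%fset.
have JE j : (j \in J) = (j < n)%N by rewrite !inE mem_iota.
have -> : path_law (cylinder n A) = P (\bigcap_(j in [set` J]) (X j @^-1` A j)).
  congr (P _); apply/seteqP; split => w h j; first by rewrite /= JE; exact: h.
  by move=> jn; apply: h; rewrite /= JE.
rewrite hX// -(big_mkord xpredT (fun j => P (X j @^-1` A j))).
apply: perm_big; apply: uniq_perm; rewrite ?fset_uniq ?iota_uniq//.
by move=> j; rewrite JE /index_iota subn0 mem_iota.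
Qed.

(** [K (except i)] integrates over a whole fresh path, but only its coordinate [i] enters, and that
    coordinate has the law of [X i]. *)
Lemma E_K i h x : measurable_fun setT h -> E_ X i h x = K path_law (except i) h x.
Proof.
move=> mh; have mx : measurable_fun setT (fun y => h (merge (except i) x y)).
  exact: (measurableT_comp mh (@measurable_merge2 _ S (except i) x)).
rewrite /K (Rintegral_distribution path_rv mx).
rewrite /E_ (Rintegral_distribution (X i)).
  apply: eq_Rintegral => w _; congr h; apply/funext => k.
  by rewrite /merge /except /=; case: eqP => // ->.
have mr : measurable_fun setT (fun y : S => ([eta x with i |-> y] : V)).
  apply: measurable_path => k /=; case: (k == i) => //; exact: measurable_cst.
exact: (measurableT_comp mh mr).
Qed.

Lemma D_K i h x : measurable_fun setT h ->
  D_ X i h x = h x - K path_law (except i) h x.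
Proof. by move=> mh; rewrite /D_ E_K. Qed.

End independent_sequence.

(** * Uniqueness of conditional expectations *)

Section conditional_expectation.
Context (R : realType) d (T : measurableType d) (P : probability T R).
Implicit Types (G : set (set T)) (H C h : T -> R).

Lemma intg_indicM A h : measurable A -> intg P h -> intg P (fun w => \1_A w * h w).
Proof.
move=> mA hi; apply: (ae_intg_le _ hi).
  by apply: measurable_funM; [exact: measurable_indic|exact: intg_measurable hi].
apply: aeW => w; rewrite indicE normrM.
by case: (w \in A); rewrite /= ?normr1 ?normr0 ?mul1r ?mul0r.
Qed.

Lemma integral_set_indic A h : measurable A -> intg P h ->
  (\int[P]_(w in A) (h w)%:E)%E = (\int[P]_w (\1_A w * h w))%:E.
Proof.
move=> mA hi; rewrite integral_mkcond -Rintegral_fin.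
  apply: eq_integral => w _; rewrite patchE indicE.
  by case: (w \in A); rewrite /= ?mul1r ?mul0r.
exact: intg_indicM.
Qed.

(* Integrate the difference over the set where it is nonnegative. *)
Lemma cond_expectation_unique G H C1 C2 : G `<=` measurable ->
  is_cond_expectation P G H C1 -> is_cond_expectation P G H C2 ->
  {ae P, forall w, C1 w = C2 w}.
Proof.
move=> Gm [m1 i1 e1] [m2 i2 e2].
have sG : <<s G >> `<=` measurable.
  by apply: smallest_sub => //; exact: sigma_algebra_measurable.
pose h w := C1 w - C2 w.
have mh : measurable_fun setT (h : g_sigma_algebraType G -> R) by exact: measurable_funB.
have hi : intg P h by exact: intgB.
pose A := h @^-1` `[0, +oo[%classic.
have GA : <<s G >> A.
  by have := mh measurableT `[0, +oo[%classic (measurable_itv _); rewrite setTI.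
have h0 B : <<s G >> B -> \int[P]_w (\1_B w * h w) = 0.
  move=> GB; have mB := sG _ GB.
  rewrite /h; under eq_Rintegral do rewrite mulrBr.
  rewrite RintegralB//; [|exact: intg_indicM..]; apply/eqP; rewrite subr_eq0; apply/eqP.
  by apply: EFin_inj; rewrite -!integral_set_indic// e1// e2.
have n0 : \int[P]_w `|h w| = 0.
  have mA := sG _ GA.
  transitivity (\int[P]_w (2 * (\1_A w * h w) - \1_setT w * h w)).
    apply: eq_Rintegral => w _; rewrite !indicE in_setT mul1r.
    have [wA|wA] := boolP (w \in A).
      have : 0 <= h w by move: wA; rewrite inE /A /= in_itv/= andbT.
      by move/ger0_norm => ->; rewrite mul1r; lra.
    have : h w <= 0.
      by rewrite leNgt; apply: contra wA => /ltW; rewrite inE /A /= in_itv/= andbT.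
    by move/ler0_norm => ->; rewrite mul0r; lra.
  have GT : <<s G >> setT by exact: (@measurableT _ (g_sigma_algebraType G)).
  have ii := intg_indicM mA hi.
  rewrite RintegralB//; [|exact: intgZ|exact: intg_indicM].
  by rewrite RintegralZl// !h0// mulr0 subrr.
have := ge0_Rintegral_eq0 (intg_norm hi) (fun w => normr_ge0 (h w)) n0.
by apply: filterS => w /normr0_eq0/eqP; rewrite subr_eq0 => /eqP.
Qed.

End conditional_expectation.

(** * Martingale differences as versions of [E[D_i F | F_i]] *)

Section clark_ocone.
Context (R : realType) d (T : measurableType d) (P : probability T R)
  d' (S : measurableType d') (X : nat -> {RV P >-> S}).
Hypothesis hX : mutually_independent X.
Local Notation V := (path_space S).
Local Notation mu := (path_law X).
Variable f : V -> R.
Hypothesis fs : sqintg mu f.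

Let muE := path_law_cylinder hX.
Let F_ i := generators [set k | (k <= i)%N] (fun k => X k : T -> S).
(** Freezing the coordinates beyond [i] at [point] gives a map measurable for [F_ i]; composing with
    it leaves functionals of the first [i.+1] coordinates unchanged. *)
Let m i : g_sigma_algebraType (F_ i) -> V :=
  fun w => merge (first i.+1) (path_rv X w) (point : V).
Arguments m : clear implicits.

Let mm i : measurable_fun setT (m i).
Proof.
apply: measurable_path => k; rewrite /m /merge /first.
case: (ltnP k i.+1) => ki; last exact: measurable_cst.
move=> _ A mA; rewrite setTI; apply: sub_sigma_algebra.
by exists k => //; exists A => //; rewrite setTI.
Qed.

(** Preimages under [m i] form a sigma-algebra containing the generators of [F_ i]. Indicators of
    events of [F_ i] thereby become test functions of the first [i.+1] coordinates. *)
Let F_preimage i A : <<s F_ i >> A -> exists2 B : set V, measurable B & A = m i @^-1` B.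
Proof.
pose G := [set A | exists2 B : set V, measurable B & A = m i @^-1` B].
suff : <<s F_ i >> `<=` G by exact.
apply: smallest_sub.
  split.
  - by exists set0; rewrite ?preimage_set0.
  - by move=> _ [B mB ->]; exists (~` B); [exact: measurableC|rewrite setTD preimage_setC].
  - move=> Fs Gs; pose B n := s2val (cid2 (Gs n)).
    exists (\bigcup_n B n).
      by apply: bigcupT_measurable => n; rewrite /B; case: cid2.
    rewrite preimage_bigcup; apply: eq_bigcupr => n _; rewrite /B.
    by case: cid2.
move=> _ [k /= ki [A' mA' <-]].
exists ((fun x : V => x k) @^-1` A').
  by rewrite -[X in measurable X]setTI; exact: measurable_coord.
by rewrite setTI; apply/seteqP; split => w /=; rewrite /m /merge /first ltnS ki.
Qed.

Lemma incr_cond_expectation i : is_cond_expectation P (F_ i)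
  (fun w => D_ X i f (sample_path X w)) (fun w => incr mu i f (path_rv X w)).
Proof.
have [mf f2] := fs; have cs := sqintg_incr muE i fs; have [mc _] := cs.
have ci : intg P (fun w => incr mu i f (path_rv X w)).
  exact/intg_distribution/(sqintg_intg cs).
have Ds : sqintg mu (fun x => f x - K mu (except i) f x).
  by apply: sqintgB => //; exact: sqintg_K.
have DE : (fun w => D_ X i f (sample_path X w)) =
    (fun w => (fun x => f x - K mu (except i) f x) (path_rv X w)).
  by apply/funext => w; rewrite D_K.
have [mD _] := Ds.
have Di : intg P (fun w => D_ X i f (sample_path X w)).
  by rewrite DE; apply/(intg_distribution (path_rv X) mD)/(sqintg_intg Ds).
split => // [|A FA].
  rewrite (_ : (fun w => _) = incr mu i f \o m i).
    exact: (measurableT_comp mc (@mm i)).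
  by apply/funext => w; rewrite /m /= (@depends_on_incr _ _ _ mu).
have [B mB AE] := F_preimage FA.
pose u (x : V) : R := \1_B (merge (first i.+1) x point).
have mA : measurable A.
  suff : <<s F_ i >> `<=` measurable by exact.
  apply: smallest_sub; first exact: sigma_algebra_measurable.
  by move=> _ [k _ [A' mA' <-]]; exact: measurable_funP.
have uA w : \1_A w = u (path_rv X w) by rewrite AE.
have mu_ : measurable_fun setT u.
  apply: measurableT_comp; first exact: measurable_indic.
  apply: measurable_path => k; rewrite /merge.
  by case: (first _ k); [exact: measurable_coord|exact: measurable_cst].
have us : sqintg mu u.
  apply: (@sqintg_bounded _ _ _ mu u 1) => // x.
  by rewrite /u indicE; case: (_ \in _); rewrite ?normr1 ?normr0.
have uD : depends_on (first i.+1) u.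
  move=> x y; rewrite /u; congr (\1_B _); apply/funext => k.
  by rewrite /merge; case: (first _ k).
rewrite !integral_set_indic//; congr EFin.
under eq_Rintegral do rewrite uA.
under [RHS]eq_Rintegral do rewrite uA.
rewrite -(@Rintegral_distribution _ _ _ _ _ P (path_rv X) (fun x => u x * incr mu i f x)); last first.
  exact: measurable_funM.
rewrite (Rintegral_mul_incr muE fs us uD).
rewrite (Rintegral_distribution (path_rv X)); last exact: measurable_funM.
by apply: eq_Rintegral => w _; rewrite D_K.
Qed.

(** The bounds involve arbitrary versions [C i]; this replaces them by the explicit increments. *)
Lemma cond_expectation_incr i (C : T -> R) :
  is_cond_expectation P (F_ i) (fun w => D_ X i f (sample_path X w)) C ->
  {ae P, forall w, C w = incr mu i f (path_rv X w)}.
Proof.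
move=> hC; apply: cond_expectation_unique hC (incr_cond_expectation i).
by move=> _ [k _ [A' mA' <-]]; exact: measurable_funP.
Qed.

End clark_ocone.

(** * Measurability and integration of series *)

Section sequences_of_functions.
Context d (T : measurableType d) (R : realType).
Local Open Scope ereal_scope.

Lemma limn_einf_esup_cvg (u : (\bar R)^nat) : limn_einf u = limn_esup u ->
  u @ \oo --> limn_esup u.
Proof.
move=> e; apply: (@squeeze_cvge _ _ _ _ (einfs u) u (esups u)).
- apply: nearW => n; apply/andP; split.
    by apply: ereal_inf_lbound; exists n => //=.
  by apply: ereal_sup_ubound; exists n => //=.
- by rewrite -e limn_einf_lim; exact: is_cvg_einfs.
- by rewrite limn_esup_lim; exact: is_cvg_esups.
Qed.

(* [limn] is the junk value [point] where the sequence diverges. *)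
Lemma measurable_limn (u : nat -> T -> \bar R) :
  (forall n, measurable_fun setT (u n)) ->
  measurable_fun setT (fun x => limn (u ^~ x)).
Proof.
move=> mu.
have me : measurable_fun setT (fun x => limn_esup (u ^~ x)).
  exact: measurable_fun_limn_esup.
have mi : measurable_fun setT (fun x => limn_einf (u ^~ x)).
  apply: measurableT_comp => //; apply: measurable_fun_limn_esup => n.
  exact: measurableT_comp.
rewrite (_ : (fun x => _) = fun x =>
    if limn_einf (u ^~ x) == limn_esup (u ^~ x) then limn_esup (u ^~ x) else point).
  by apply: measurable_fun_ifT => //; exact: measurable_fun_eqe.
apply/funext => x; case: ifPn => [/eqP/limn_einf_esup_cvg/cvg_lim ->//|ne].
apply: dvgP => h; move/eqP: ne; apply.
by rewrite is_cvg_limn_einfE// is_cvg_limn_esupE.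
Qed.

(** The terms are nonnegative only almost everywhere, so the pointwise series may fail to converge
    on a null set. Truncating at 0 changes nothing outside countably many null sets and makes the
    exchange of sum and integral legitimate. *)
Lemma sum_integral_max0_le (P : probability T R) (a : nat -> T -> R) n :
  (forall i, measurable_fun setT (a i)) ->
  (forall i, {ae P, forall w, (0 <= a i w)%R}) ->
  \sum_(i < n) \int[P]_w (Num.max 0%R (a i w))%:E <=
  \int[P]_w \sum_(0 <= i <oo) (a i w)%:E.
Proof.
move=> ma a0; pose b i w : R := Num.max 0%R (a i w).
have mb i : measurable_fun setT (EFin \o b i).
  by apply/measurable_EFinP; exact: measurable_maxr.
have b0 i w : 0 <= (b i w)%:E by rewrite lee_fin /b le_max lexx.
have -> : \int[P]_w \sum_(0 <= i <oo) (a i w)%:E =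
    \int[P]_w \sum_(0 <= i <oo) (b i w)%:E.
  apply: ae_eq_integral => //.
  - apply: measurable_limn => k; apply: emeasurable_sum => i.
    exact/measurable_EFinP.
  - by apply: measurable_limn => k; exact: emeasurable_sum.
  - apply: filterS (ae_foralln a0) => w h _; apply: congr_lim.
    by apply/funext => k; apply: eq_bigr => i _; rewrite /b max_r.
rewrite integral_nneseries//.
apply: le_trans (nneseries_lim_ge n _) => [|i _ _]; last exact: integral_ge0.
by rewrite big_mkord.
Qed.

End sequences_of_functions.

(** * L1 convergence tested against bounded functions *)

Section L1_convergence.
Context d (T : measurableType d) (R : realType) (P : probability T R).

Lemma cvg_Rintegral_bounded (s : nat -> T -> R) (Z v : T -> R) :
  (forall n, intg P (s n)) -> intg P Z ->
  (\int[P]_w `|s n w - Z w| @[n --> \oo] --> (0 : R)) ->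
  measurable_fun setT v -> (forall w, `|v w| <= 1) ->
  \int[P]_w (v w * s n w) @[n --> \oo] --> \int[P]_w (v w * Z w).
Proof.
move=> si Zi sZ mv v1; apply/cvgrPdist_le => e e0.
have vi h : intg P h -> intg P (fun w => v w * h w).
  move=> hi; apply: (intg_le _ (intg_norm hi)).
    by apply: measurable_funM => //; exact: intg_measurable hi.
  by move=> w; rewrite normrM ler_piMl.
move/cvgrPdist_le : sZ => /(_ e e0); apply: filterS => n.
rewrite sub0r normrN => /(le_trans (ler_norm _)); apply: le_trans.
rewrite distrC -RintegralB//; [|exact: vi..].
apply: le_trans (le_normr_Rintegral measurableT (intgB (vi _ (si n)) (vi _ Zi))) _.
apply: ae_Rintegral_le.
- exact: intg_norm (intgB (vi _ (si n)) (vi _ Zi)).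
- exact: intg_norm (intgB (si n) Zi).
- by apply: aeW => w; rewrite -mulrBr normrM ler_piMl.
Qed.

Lemma L1_sum_cvg (u : nat -> T -> R) (Z v : T -> R) :
  (forall i, intg P (u i)) -> L1_sum P u Z ->
  measurable_fun setT v -> (forall w, `|v w| <= 1) ->
  \int[P]_w (v w * \sum_(i < n) u i w) @[n --> \oo] --> \int[P]_w (v w * Z w).
Proof.
move=> ui [/Lfun1_integrable Zi hZ] mv v1.
have si n : intg P (fun w => \sum_(i < n) u i w) by exact: intg_sum.
apply: cvg_Rintegral_bounded => //.
move: hZ => /fine_cvgP[_]; apply: cvg_trans; apply: near_eq_cvg.
apply: nearW => n /=; rewrite unlock; congr fine.
by apply: eq_integral => w _; rewrite big_mkord.
Qed.

End L1_convergence.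

(** * The second-order bound *)

Section remainder.
Context d' (S : measurableType d') (R : realType).
Local Notation V := (path_space S).
Variables (mu : probability V R) (f : V -> R).
Hypothesis mf : measurable_fun setT f.
Implicit Types (x y : V) (t : R) (D : pred nat).

Lemma ind_gtE t x : ind_gt f t x = (t < f x)%R%:R.
Proof. by rewrite /ind_gt indicE mem_setE. Qed.

Lemma measurable_ind_gt t : measurable_fun setT (ind_gt f t : V -> R).
Proof.
apply: measurable_indic.
rewrite (_ : [set x | _] = f @^-1` `]t, +oo[%classic).
  by rewrite -[X in measurable X]setTI; exact: mf.
by apply/seteqP; split => x /=; rewrite in_itv/= andbT.
Qed.

Lemma ind_gt_bounded t x : `|ind_gt f t x : R| <= 1.
Proof. by rewrite ind_gtE; case: (_ < _); rewrite /= ?normr1 ?normr0. Qed.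

(** [stein_taylor] with [a = f x] and [b = f (merge D x y)], integrated over [y]. Its factor 1/2
    becomes the one in [d_]. *)
Lemma stein_remainder D t x : sqintg mu (fun y => f (merge D x y)) ->
  `|stein t (f x) - K mu D (fun y => stein t (f y)) x -
    dstein t (f x) * (f x - K mu D f x)| <=
  (`|f x| + Num.sqrt (2 * pi) / 4) *
    (2^-1 * \int[mu]_y (`|f x - f (merge D x y)| ^+ 2)) +
  \int[mu]_y ((f (merge D x y) - f x) * (ind_gt f t (merge D x y) - ind_gt f t x)).
Proof.
set A := `|f x| + _ => fs; have fi := sqintg_intg fs.
have mm : measurable_fun setT (merge D x) by exact: measurable_merge2.
have ds : sqintg mu (fun y => f x - f (merge D x y)).
  exact: sqintgB (sqintg_cst _ _) fs.
have [_ d2] := ds; have di := sqintg_intg ds.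
have d2' : intg mu (fun y => `|f x - f (merge D x y)| ^+ 2).
  by apply: eq_integrable d2 => // y _ /=; rewrite real_normK// num_real.
have si : intg mu (fun y => stein t (f (merge D x y))).
  apply: (@intg_bounded _ _ _ mu _ (Num.sqrt (2 * pi) / 4)) => [|y].
    apply: measurableT_comp; first exact: measurable_stein.
    exact: measurableT_comp.
  by rewrite ger0_norm ?stein_ge0// stein_le.
have is_ : sqintg mu (fun y => ind_gt f t (merge D x y) - ind_gt f t x).
  apply: sqintgB (sqintg_cst _ _); apply: (@sqintg_bounded _ _ _ mu _ 1).
    exact: measurableT_comp (measurable_ind_gt t) mm.
  by move=> y; exact: ind_gt_bounded.
have fis : intg mu (fun y =>
    (f (merge D x y) - f x) * (ind_gt f t (merge D x y) - ind_gt f t x)).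
  by apply: sqintgM is_; apply: sqintgB fs (sqintg_cst _ _).
have li : intg mu (fun y => stein t (f x) - stein t (f (merge D x y)) -
    dstein t (f x) * (f x - f (merge D x y))).
  by apply: intgB; [apply: intgB => //; exact: intg_cst|exact: intgZ].
have -> : stein t (f x) - K mu D (fun y => stein t (f y)) x -
    dstein t (f x) * (f x - K mu D f x) =
    \int[mu]_y (stein t (f x) - stein t (f (merge D x y)) -
      dstein t (f x) * (f x - f (merge D x y))).
  rewrite RintegralB//; [|apply: intgB => //; exact: intg_cst|exact: intgZ].
  rewrite RintegralZl// !RintegralB//; try exact: intg_cst.
  by rewrite !Rintegral_cst1.
apply: le_trans (le_normr_Rintegral measurableT li) _.
rewrite -RintegralZl// -RintegralZl//; last exact: intgZ.
rewrite -RintegralD//; last by do 2 apply: intgZ.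
apply: ae_Rintegral_le.
- exact: intg_norm.
- by apply: intgD => //; do 2 apply: intgZ.
- apply: aeW => y; rewrite !ind_gtE.
  have := stein_taylor t (f x) (f (merge D x y)).
  (* The expansion goes from [f x] to the resampled value, while [D_i] subtracts the resampled
     value, hence the change of sign. *)
  rewrite -normrN (_ : - (_ - _ - _ * _) = stein t (f x) - stein t (f (merge D x y)) -
      dstein t (f x) * (f x - f (merge D x y))); last by ring.
  move=> /le_trans; apply; rewrite lerD2r -/A -mulrA real_normK ?num_real//.
  by rewrite -(sqrrN (_ - f x)) opprB [_ / 2]mulrC.
Qed.

End remainder.

(** * Comparison of [E[F g(F)]] with [E[g'(F) Z]] *)

Section second_order_bound.
Context (R : realType) d (T : measurableType d) (P : probability T R)
  d' (S : measurableType d') (X : nat -> {RV P >-> S}).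
Hypothesis hX : mutually_independent X.
Local Notation V := (path_space S).
Local Notation mu := (path_law X).
Variable f : V -> R.
Hypothesis fs : sqintg mu f.
Hypothesis f0 : \int[mu]_x f x = 0.
Variable C : nat -> T -> R.
Hypothesis hC : forall i, is_cond_expectation P
  (generators [set k | (k <= i)%N] (fun k => X k : T -> S))
  (fun w => D_ X i f (sample_path X w)) (C i).

Local Notation sp := (sample_path X).
Implicit Types (u : V -> R) (t : R) (w : T).
Let muE := path_law_cylinder hX.
Let mf : measurable_fun setT f. Proof. by case: fs. Qed.

Let CE i : {ae P, forall w, C i w = incr mu i f (path_rv X w)}.
Proof. exact: (cond_expectation_incr hX fs (hC i)). Qed.

Let mC i : measurable_fun setT (C i).
Proof. by have [_ /measurable_int/measurable_EFinP] := hC i. Qed.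

Let Drem i u x := u x - K mu (except i) u x.

Let Drem_sqintg i u : sqintg mu u -> sqintg mu (Drem i u).
Proof. by move=> us; apply: sqintgB => //; exact: sqintg_K. Qed.

Let intgCM i u : sqintg mu u -> intg P (fun w => C i w * u (path_rv X w)).
Proof.
move=> us; have [mu_ _] := us; have cs := sqintg_incr muE i fs.
have /(intg_distribution (path_rv X)) h := sqintgM cs us.
have [mc _] := cs.
have {}h : intg P (fun w => incr mu i f (path_rv X w) * u (path_rv X w)).
  by apply: h; exact: measurable_funM.
apply: (ae_intg_le _ h).
  by apply: measurable_funM => //; exact: measurableT_comp.
by apply: filterS (CE i) => w ->.
Qed.

Let RintegralCM i u : sqintg mu u ->
  \int[P]_w (C i w * u (path_rv X w)) = \int[mu]_x (incr mu i f x * u x).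
Proof.
move=> us; have [mu_ _] := us; have [mc _] := sqintg_incr muE i fs.
rewrite (Rintegral_distribution (path_rv X)); last exact: measurable_funM.
apply: ae_Rintegral_eq.
- by apply: measurable_funM => //; exact: measurableT_comp.
- by apply: measurable_funM; exact: measurableT_comp.
- by apply: filterS (CE i) => w ->.
Qed.

(** Orthogonality puts [D_i] on [u], then the increments are summed. Used with [u = stein t \o f]
    for the main bound and with [u = f] for the mean of [Z]. *)
Lemma covariance_cvg u : sqintg mu u ->
  \sum_(i < n) \int[P]_w (C i w * Drem i u (path_rv X w)) @[n --> \oo] -->
  \int[P]_w (u (path_rv X w) * f (path_rv X w)).
Proof.
move=> us; have [mu_ _] := us.
rewrite -(@Rintegral_distribution _ _ _ _ _ P (path_rv X) (fun x => u x * f x)); last first.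
  exact: measurable_funM.
have := sum_Rintegral_incr_cvg muE fs us f0; apply: cvg_trans.
apply: near_eq_cvg; apply: nearW => n; apply: eq_bigr => i _.
by rewrite (Rintegral_incrM muE _ fs us) -RintegralCM//; exact: Drem_sqintg.
Qed.

Let DE i u w : measurable_fun setT u -> D_ X i u (sp w) = Drem i u (path_rv X w).
Proof. by move=> mu_; rewrite D_K. Qed.

Lemma intg_DC i : intg P (fun w => D_ X i f (sp w) * C i w).
Proof.
apply: eq_integrable (intgCM i (Drem_sqintg i fs)) => // w _ /=.
by rewrite DE// mulrC.
Qed.

Let a t i w : R :=
  (D_ X i f (sp w) * D_ X i (ind_gt f t) (sp w) +
   E_ X i (fun x => D_ X i f x * D_ X i (ind_gt f t) x) (sp w)) * `|C i w|.

Let b i w : R :=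
  (`|f (sp w)| + Num.sqrt (2 * pi) / 4) * d_ X i f (sp w) ^+ 2 * `|C i w|.

Let mD i u : measurable_fun setT u ->
  measurable_fun setT (fun x : V => D_ X i u x).
Proof.
move=> mu_; rewrite (_ : (fun x => _) = Drem i u).
  by apply: measurable_funB => //; exact: measurable_K.
by apply/funext => x; rewrite D_K.
Qed.

Let ma t i : measurable_fun setT (a t i).
Proof.
have mi := measurable_ind_gt mf t.
have mDD : measurable_fun setT (fun x : V => D_ X i f x * D_ X i (ind_gt f t) x).
  by apply: measurable_funM; exact: mD.
pose e x := K mu (except i) (fun x : V => D_ X i f x * D_ X i (ind_gt f t) x) x.
have me : measurable_fun setT e by exact: (measurable_K mu (except i) mDD).
have eE w : E_ X i (fun x => D_ X i f x * D_ X i (ind_gt f t) x) (sp w) = e (path_rv X w).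
  by rewrite E_K.
apply: measurable_funM; last exact: measurableT_comp.
under eq_fun do rewrite eE.
by apply: measurable_funD; [exact: (measurableT_comp mDD (measurable_path_rv X))|
  exact: (measurableT_comp me (measurable_path_rv X))].
Qed.

Let d_sqrE i (x : V) : d_ X i f x ^+ 2 =
  2^-1 * \int[mu]_y (`|f x - f (merge (except i) x y)| ^+ 2).
Proof.
rewrite /d_ sqr_sqrtr; last first.
  by rewrite mulr_ge0//; apply: Rintegral_ge0 => y _; exact: sqr_ge0.
(* [E_K] is applied to the functional [z |-> |f x - f z| ^+ 2], in which the base point [x] stays
   frozen. *)
congr (_ * _); apply: (@E_K _ _ _ _ _ _ X i (fun z => `|f x - f z| ^+ 2) x).
by apply: measurable_funX; apply: measurableT_comp => //; exact: measurable_funB.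
Qed.

Let mb i : measurable_fun setT (b i).
Proof.
pose q (x : V) := \int[mu]_y (`|f x - f (merge (except i) x y)| ^+ 2).
have mq : measurable_fun setT q.
  apply: (measurable_Rintegral_fst mu (k := fun p => `|f p.1 - f (mergep (except i) p)| ^+ 2)).
  apply: measurable_funX; apply: measurableT_comp => //; apply: measurable_funB.
    exact: measurableT_comp.
  exact: measurable_merge_comp.
have qE w : d_ X i f (sp w) ^+ 2 = 2^-1 * q (path_rv X w) by exact: d_sqrE.
apply: measurable_funM; last exact: measurableT_comp.
under eq_fun do rewrite qE.
apply: measurable_funM; last by apply: measurable_funM => //; exact: measurableT_comp.
apply: measurable_funD => //; apply: measurableT_comp => //.
exact: (measurableT_comp mf (measurable_path_rv X)).
Qed.

Let b_ge0 i w : 0 <= b i w.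
Proof. by rewrite /b mulr_ge0// mulr_ge0 ?sqr_ge0// addr_ge0// divr_ge0. Qed.

Let section_P i : {ae P, forall w, sqintg mu (fun y => f (merge (except i) (path_rv X w) y))}.
Proof.
exact: (@ae_distribution _ _ _ _ _ P (path_rv X)
  (fun x => sqintg mu (fun y => f (merge (except i) x y))) (sqintg_section muE (except i) fs)).
Qed.

Let aE t i w : sqintg mu (fun y => f (merge (except i) (path_rv X w) y)) ->
  a t i w = (\int[mu]_y ((f (merge (except i) (path_rv X w) y) - f (path_rv X w)) *
    (ind_gt f t (merge (except i) (path_rv X w) y) - ind_gt f t (path_rv X w)))) * `|C i w|.
Proof.
move=> fw; have mi := measurable_ind_gt mf t.
rewrite /a; congr (_ * _).
have iw : sqintg mu (fun y => ind_gt f t (merge (except i) (path_rv X w) y)).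
  apply: (@sqintg_bounded _ _ _ mu _ 1) => [|y]; last exact: ind_gt_bounded.
  exact: measurableT_comp mi (@measurable_merge2 _ S (except i) _).
rewrite -(K_covE fw iw) !DE// E_K; last by apply: measurable_funM; exact: mD.
congr (_ + _); apply: eq_Rintegral => y _.
by rewrite !D_K.
Qed.

(** The indicator is nondecreasing in the value of [f], so the two differences in [aE] have the same
    sign. *)
Let a_ge0 t i : {ae P, forall w, 0 <= a t i w}.
Proof.
apply: filterS (section_P i) => w /aE ->.
rewrite mulr_ge0//; apply: Rintegral_ge0 => y _; rewrite !ind_gtE.
case: (ltP t (f (merge (except i) (path_rv X w) y))) => h1;
  case: (ltP t (f (path_rv X w))) => h2 /=; nra.
Qed.

Let G t x := stein t (f x).

Let Gs t : sqintg mu (G t).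
Proof.
apply: (@sqintg_bounded _ _ _ mu _ (Num.sqrt (2 * pi) / 4)) => [|x].
  by apply: measurableT_comp => //; exact: measurable_stein.
by rewrite ger0_norm ?stein_ge0// stein_le.
Qed.

(** The error made when [g'(F) D_i F] replaces [D_i g(F)], weighted by [C i]. *)
Let r t i w := C i w * Drem i (G t) (path_rv X w) -
  dstein t (f (path_rv X w)) * (D_ X i f (sp w) * C i w).

Let dstein_intg t h : intg P h ->
  intg P (fun w => dstein t (f (path_rv X w)) * h w).
Proof.
move=> hi; apply: (intg_le _ (intg_norm hi)) => [|w].
  apply: measurable_funM; last exact: intg_measurable hi.
  apply: measurableT_comp; first exact: measurable_dstein.
  exact: measurableT_comp.
by rewrite normrM ler_piMl// dstein_le1.
Qed.

Let r_intg t i : intg P (r t i).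
Proof.
apply: intgB; first exact: intgCM (Drem_sqintg i (Gs t)).
exact: dstein_intg (intg_DC i).
Qed.

Let r_le t i : {ae P, forall w, `|r t i w| <= a t i w + b i w}.
Proof.
apply: filterS (section_P i) => w fw.
have := stein_remainder mf t fw.
rewrite (aE t fw) /b d_sqrE -mulrDl [X in _ <= X * _]addrC.
move=> /(ler_wpM2r (normr_ge0 (C i w))); apply: le_trans.
rewrite -normrM /r DE// /Drem /G.
by rewrite le_eqVlt; apply/orP; left; apply/eqP; congr `| _ |; ring.
Qed.

Local Open Scope ereal_scope.

(** The integrals on the right may be infinite, so the bound lives in the extended reals; the
    truncations at 0 make both integrands nonnegative everywhere, as additivity there requires. *)
Let r_integral_le t i : `|\int[P]_w r t i w|%R%:E <=
  \int[P]_w (Num.max 0%R (a t i w))%:E + \int[P]_w (Num.max 0%R (b i w))%:E.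
Proof.
have mr := intg_measurable (r_intg t i).
have mma : measurable_fun setT (fun w => (Num.max 0%R (a t i w))%:E).
  by apply/measurable_EFinP; exact: measurable_maxr.
have mmb : measurable_fun setT (fun w => (Num.max 0%R (b i w))%:E).
  by apply/measurable_EFinP; exact: measurable_maxr.
apply: (@le_trans _ _ (\int[P]_w `|r t i w|%R%:E)).
  rewrite Rintegral_fin; last exact: intg_norm.
  by rewrite lee_fin; exact: le_normr_Rintegral.
rewrite -ge0_integralD//; try by move=> w _; rewrite lee_fin le_max lexx.
apply: ae_ge0_le_integral => //.
- by apply/measurable_EFinP; exact: measurableT_comp.
- by move=> w _; rewrite adde_ge0// lee_fin le_max lexx.
- exact: emeasurable_funD.
- apply: filterS (r_le t i) => w h _; rewrite -EFinD lee_fin (le_trans h)//.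
  by rewrite lerD// le_max lexx orbT.
Qed.

Let I t : \bar R := \int[P]_w \sum_(0 <= i <oo) (a t i w)%:E.

Let I_le_B1 t : I t <= B1 X f C.
Proof. by apply: ereal_sup_ubound; exists t. Qed.

(** The partial sums of the covariance formula and those of [Z] weighted by [dstein] differ by a
    finite sum of remainders, bounded uniformly in [n]; the bound then passes to the limit of
    both. *)
Lemma covariance_stein_le (Z : T -> R) t :
  L1_sum P (fun i w => (D_ X i f (sp w) * C i w)%R) Z ->
  `|\int[P]_w (dstein t (f (path_rv X w)) * Z w) -
    \int[P]_w (stein t (f (path_rv X w)) * f (path_rv X w))|%R%:E <=
  B1 X f C + B2 X f C.
Proof.
move=> hZ; have [/Lfun1_integrable Zi _] := hZ.
apply: (@le_trans _ _ (I t + B2 X f C)); last exact/leeD2r/I_le_B1.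
have cL := covariance_cvg (Gs t).
have cM : (\int[P]_w (dstein t (f (path_rv X w)) *
      \sum_(i < n) (D_ X i f (sp w) * C i w)) @[n --> \oo] -->
    \int[P]_w (dstein t (f (path_rv X w)) * Z w))%R.
  apply: (L1_sum_cvg intg_DC hZ).
    exact: (measurableT_comp (measurable_dstein t) (measurableT_comp mf (measurable_path_rv X))).
  by move=> w; exact: dstein_le1.
have E n : (\sum_(i < n) \int[P]_w (C i w * Drem i (G t) (path_rv X w)) -
    \int[P]_w (dstein t (f (path_rv X w)) * \sum_(i < n) (D_ X i f (sp w) * C i w)) =
    \sum_(i < n) \int[P]_w r t i w)%R.
  rewrite [X in (_ - X)%R](_ : _ = \sum_(i < n) \int[P]_w
      (dstein t (f (path_rv X w)) * (D_ X i f (sp w) * C i w)))%R; last first.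
    rewrite -Rintegral_sum => [|i]; last exact: dstein_intg (intg_DC i).
    by apply: eq_Rintegral => w _; rewrite mulr_sumr.
  rewrite -sumrB; apply: eq_bigr => i _; rewrite RintegralB//.
    exact: intgCM (Drem_sqintg i (Gs t)).
  exact: dstein_intg (intg_DC i).
have le_n n : `|\sum_(i < n) \int[P]_w r t i w|%R%:E <= I t + B2 X f C.
  apply: (@le_trans _ _ (\sum_(i < n) `|\int[P]_w r t i w|%R%:E)).
    by rewrite sumEFin lee_fin; exact: ler_norm_sum.
  apply: (@le_trans _ _ (\sum_(i < n) (\int[P]_w (Num.max 0%R (a t i w))%:E +
      \int[P]_w (Num.max 0%R (b i w))%:E))).
    by apply: lee_sum => i _; exact: r_integral_le.
  rewrite big_split/=; apply: leeD.
    exact: sum_integral_max0_le (ma t) (a_ge0 t).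
  by apply: sum_integral_max0_le mb _ => i; apply: aeW => w; exact: b_ge0.
have cr := cvgB cL cM.
have {}cr : (`|\sum_(i < n) \int[P]_w r t i w| @[n --> \oo] -->
    `|\int[P]_w (dstein t (f (path_rv X w)) * Z w) -
    \int[P]_w (stein t (f (path_rv X w)) * f (path_rv X w))|)%R.
  by rewrite distrC; apply: cvg_norm; under eq_fun do rewrite -E; exact: cr.
(* A bound [+oo] is trivial, and [-oo] is excluded by the empty sum at [n = 0]. *)
case: (I t + B2 X f C) le_n => [B| |] le_n.
- by rewrite lee_fin; apply: (cvgr_to_le cr); apply: nearW => n; rewrite -lee_fin.
- exact: leey.
- by have := le_n 0%N.
Qed.

Lemma Rintegral_L1_sum (Z : T -> R) :
  L1_sum P (fun i w => (D_ X i f (sp w) * C i w)%R) Z ->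
  (\int[P]_w Z w = \int[P]_w (f (path_rv X w) ^+ 2))%R.
Proof.
move=> hZ.
have cM : (\int[P]_w (1 * \sum_(i < n) (D_ X i f (sp w) * C i w)) @[n --> \oo] -->
    \int[P]_w (1 * Z w))%R.
  by apply: (L1_sum_cvg intg_DC hZ) => // w; rewrite normr1.
have E n : (\sum_(i < n) \int[P]_w (C i w * Drem i f (path_rv X w)) =
    \int[P]_w (1 * \sum_(i < n) (D_ X i f (sp w) * C i w)))%R.
  under [RHS]eq_Rintegral do rewrite mul1r.
  rewrite Rintegral_sum => [|i]; last exact: intg_DC.
  by apply: eq_bigr => i _; apply: eq_Rintegral => w _; rewrite DE// mulrC.
have := covariance_cvg fs; under eq_fun do rewrite E.
move=> /(cvg_unique _ cM) => /(_ (@Rhausdorff R)).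
by under eq_Rintegral do rewrite mul1r.
Qed.

End second_order_bound.

(** Triangle inequality through the mean [m], then Jensen's inequality for [|Z - m|]. An infinite
    variance makes the right side [+oo]. *)
Lemma expectation_norm_1B_le d (T : measurableType d) (R : realType)
    (P : probability T R) (Z : T -> R) (m : R) : intg P Z -> \int[P]_w Z w = m ->
  ('E_P[fun w => `|1 - Z w|%R] <= `|1 - m%:E| + sqrte 'V_P[Z])%E.
Proof.
move=> Zi Zm; have ZmE : fine 'E_P[Z] = m by rewrite unlock.
have mi : intg P (fun w => Z w - m) by apply: intgB => //; exact: intg_cst.
have i1 : intg P (fun w => `|1 - Z w|).
  by apply: intg_norm; apply: intgB => //; exact: intg_cst.
have E1 : ('E_P[fun w => `|1 - Z w|%R] <= (`|1 - m| + \int[P]_w `|Z w - m|)%:E)%E.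
  rewrite unlock Rintegral_fin// lee_fin -[X in X + _](Rintegral_cst1 P).
  rewrite -RintegralD//; [|exact: intg_cst|exact: intg_norm].
  apply: ae_Rintegral_le => //; first by apply: intgD; [exact: intg_cst|exact: intg_norm].
  apply: aeW => w; rewrite -(subrKA m) (le_trans (ler_normD _ _))// lerD2l.
  by rewrite distrC.
apply: (le_trans E1); rewrite EFinD; apply: leeD => //.
have VE : 'V_P[Z] = (\int[P]_w ((Z w - m) ^+ 2)%:E)%E.
  rewrite /variance unlock ZmE unlock; apply: eq_integral => w _.
  by rewrite expr2.
have [V0|] := ltP 'V_P[Z] +oo%E; last by rewrite leye_eq => /eqP ->; exact: leey.
have ms : sqintg P (fun w => Z w - m).
  have mm := intg_measurable mi; split => //; apply/integrableP; split.
    by apply/measurable_EFinP; exact: measurable_funX.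
  move: V0; rewrite VE; apply: le_lt_trans; rewrite le_eqVlt; apply/orP; left.
  by apply/eqP; apply: eq_integral => w _ /=; rewrite ger0_norm// sqr_ge0.
have [_ m2] := ms; rewrite VE Rintegral_fin//= lee_fin.
rewrite -[leLHS]ger0_norm; last exact: Rintegral_ge0.
rewrite -sqrtr_sqr ler_wsqrtr//.
have ns : sqintg P (fun w => `|Z w - m|).
  split; first exact: intg_measurable (intg_norm mi).
  by apply: eq_integrable m2 => // w _ /=; rewrite real_normK// num_real.
apply: le_trans (sqr_Rintegral_le ns) _.
by under eq_Rintegral do rewrite real_normK ?num_real//.
Qed.

Theorem theorem3p3 (R : realType)
    (d : measure_display) (T : measurableType d) (P : probability T R)
    (d' : measure_display) (S : measurableType d')
    (X : nat -> {RV P >-> S}) (hX : mutually_independent X)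
    (f : (nat -> S) -> R) (hf : measurable_functional f)
    (F : {RV P >-> R}) (hF : forall w, F w = f (sample_path X w))
    (F_L2 : (F : T -> R) \in Lfun P 2%:E) (F_mean0 : ('E_P[F] = 0)%E)
    (C : nat -> T -> R)
    (hC : forall i, is_cond_expectation P
       (generators [set k | (k <= i)%N] (fun k => X k : T -> S))
       (fun w => D_ X i f (sample_path X w)) (C i))
    (Z : T -> R)
    (hZ : L1_sum P (fun i w => D_ X i f (sample_path X w) * C i w) Z)
    (d0 : measure_display) (T0 : measurableType d0) (Q : probability T0 R)
    (N : {RV Q >-> R}) (hN : standard_normal N) :
  (d_K F N <= 'E_P[fun w => `|1 - Z w|%R] + B1 X f C + B2 X f C)%E /\
  ('E_P[fun w => `|1 - Z w|%R] + B1 X f C + B2 X f C <=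
   `|1 - 'E_P[fun w => (F w ^+ 2)%R]| + sqrte 'V_P[Z] + B1 X f C + B2 X f C)%E.
Proof.
have mf : measurable_fun setT (f : path_space S -> R) by [].
have FE : (F : T -> R) = fun w => f (path_rv X w) by apply/funext => w; exact: hF.
have F2 : intg P (fun w => F w ^+ 2) by exact: Lfun2_integrable_sqr.
have fs : sqintg (path_law X) f.
  split => //; apply/intg_distribution; first exact: measurable_funX.
  by move: F2; rewrite FE.
have f0 : \int[path_law X]_x f x = 0.
  rewrite (Rintegral_distribution (path_rv X) mf).
  by move: F_mean0; rewrite unlock FE /Rintegral => ->.
have [/Lfun1_integrable Zi _] := hZ.
have i1 : intg P (fun w => 1 - Z w) by apply: intgB => //; exact: intg_cst.
split.
- apply: ge_ereal_sup => _ [t _ <-].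
  have mst : measurable_fun setT (fun w => stein t (F w)).
    exact: measurableT_comp (measurable_stein t) _.
  have mds : measurable_fun setT (fun w => dstein t (F w)).
    exact: measurableT_comp (measurable_dstein t) _.
  have ss : sqintg P (fun w => stein t (F w)).
    apply: (@sqintg_bounded _ _ _ P _ (Num.sqrt (2 * pi) / 4)) => // w.
    by rewrite ger0_norm ?stein_ge0// stein_le.
  have dsi : intg P (fun w => dstein t (F w)).
    by apply: (@intg_bounded _ _ _ P _ 1) => // w; exact: dstein_le1.
  have dsZ h : intg P h -> intg P (fun w => dstein t (F w) * h w).
    move=> hi; apply: (intg_le _ (intg_norm hi)) => [|w].
      by apply: measurable_funM => //; exact: intg_measurable hi.
    by rewrite normrM ler_piMl// dstein_le1.
  have sF : intg P (fun w => stein t (F w) * F w).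
    by apply: sqintgM => //; split.
  have mle : measurable [set w | F w <= t].
    rewrite (_ : [set w | _] = F @^-1` `]-oo, t]).
      by rewrite -[X in measurable X]setTI; exact: measurable_funP.
    by apply/seteqP; split => w /=; rewrite in_itv.
  have -> : cdf F t = (\int[P]_w (F w <= t)%R%:R)%:E.
    rewrite /cdf -Rintegral_fin; last first.
      apply: (intg_le _ (intg_cst P 1)) => [|w]; last first.
        by case: (F w <= t); rewrite /= ?normr1 ?normr0.
      rewrite (_ : (fun w => _) = \1_[set w | F w <= t]); first exact: measurable_indic.
      by apply/funext => w; rewrite indicE mem_setE.
    rewrite (_ : (fun w => _) = fun w => (\1_[set w | F w <= t] w)%:E); last first.
      by apply/funext => w; rewrite indicE mem_setE.
    rewrite integral_indic// setIT -[LHS]/(P (F @^-1` `]-oo, t])).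
    by congr (P _); apply/seteqP; split => w /=; rewrite in_itv.
  have -> : cdf N t = (Phi t)%:E.
    by rewrite /cdf hN// /Phi fineK// fin_num_measure.
  (* Stein's equation solved for the indicator; the constant [Phi t] then cancels against the
     distribution function of [N]. *)
  have -> : (\int[P]_w (F w <= t)%R%:R =
      \int[P]_w (dstein t (F w) - stein t (F w) * F w + Phi t)).
    by apply: eq_Rintegral => w _; rewrite /dstein; ring.
  rewrite -EFinB RintegralD//; [|exact: intgB|exact: intg_cst].
  rewrite Rintegral_cst1 addrK RintegralB//.
  (* Writing [1 = (1 - Z) + Z] separates the part controlled by [E|1 - Z|], since [|dstein| <= 1],
     from the part compared with [E[F g(F)]]. *)
  have -> : \int[P]_w dstein t (F w) =
      \int[P]_w (dstein t (F w) * (1 - Z w)) + \int[P]_w (dstein t (F w) * Z w).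
    rewrite -RintegralD//; [|exact: dsZ..].
    by apply: eq_Rintegral => w _; ring.
  rewrite -addrA /=; apply: (@le_trans _ _ (`|\int[P]_w (dstein t (F w) * (1 - Z w))|%:E +
     `|\int[P]_w (dstein t (F w) * Z w) - \int[P]_w (stein t (F w) * F w)|%:E)%E).
    by rewrite -EFinD lee_fin ler_normD.
  rewrite -addeA; apply: leeD; last by rewrite FE; exact: (covariance_stein_le hX fs f0 hC t hZ).
  rewrite unlock Rintegral_fin; last exact: intg_norm.
  rewrite lee_fin; apply: le_trans (le_normr_Rintegral _ (dsZ _ i1)) _ => //.
  apply: ae_Rintegral_le; [exact: intg_norm (dsZ _ i1)|exact: intg_norm|].
  by apply: aeW => w; rewrite normrM ler_piMl// dstein_le1.
- do 2 apply: leeD2r.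
  have -> : ('E_P[fun w => (F w ^+ 2)%R] = (\int[P]_w (F w ^+ 2)%R)%:E)%E.
    by rewrite unlock Rintegral_fin.
  apply: expectation_norm_1B_le => //.
  by rewrite (Rintegral_L1_sum hX fs f0 hC hZ) FE.
Qed.
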